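(* Let $X,Y$ be two locally compact Polish spaces and let $c\colon X\times Y\to\mathbb{R}$ be a bounded Lipschitz function. Let $\mu$ and $\nu$ be Borel probability measures on $X$ and $Y$ respectively. Then the supremum of integrals $$\int_X \phi \,d\mu-\int_Y \psi \,d\nu$$ taken over the set of continuous, bounded functions $\phi\in\mathcal{C}(X),\psi\in\mathcal{C}(Y)$ such that $$\phi(x)-\psi(y)\leq c(x,y)\quad\text{for all }x\in X,\ y\in Y$$ is equal to the infimum of integrals $$\int_{X\times Y} c\,d\pi$$ over all $\pi\in \Gamma (\mu,\nu)$, where $\Gamma(\mu,\nu)$ is the set of all Borel probability measures on $X\times Y$ whose marginals are $\mu$ and $\nu$ respectively. Moreover, both the supremum and the infimum are attained.
   Context: $\mathcal{C}(X)$ denotes the space of bounded continuous real functions on $X$. The Polish spaces are regarded as equipped with metrics inducing their topologies, with respect to which (and the corresponding product metric) $c$ is Lipschitz. *)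

(* Defs.v *)
From HB Require Import structures.
From mathcomp Require Import all_boot all_order all_algebra.
From mathcomp Require Import all_classical all_reals all_analysis.

Set Implicit Arguments.
Unset Strict Implicit.
Unset Printing Implicit Defensive.

Import Order.TTheory GRing.Theory Num.Theory.
Import numFieldNormedType.Exports.

Local Open Scope classical_set_scope.
Local Open Scope ring_scope.

(* Measurable types are pointed in the library. This costs no generality here:
   a space that carries a probability measure is nonempty. *)
#[short(type="pmetricType")]
HB.structure Definition PointedMetric (K : numDomainType) :=
  {M of Metric K M & Pointed M}.

Section Polish.
Context (R : realType) (T : topologicalType).

Definition separable_space : Prop := exists2 D : set T, countable D & dense D.

Definition metric_axioms (d : T -> T -> R) : Prop :=
  [/\ forall x y, 0 <= d x y,
      forall x y, d x y = 0 <-> x = y,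
      forall x y, d x y = d y x &
      forall x y z, d x z <= d x y + d y z].

Definition induces_topology (d : T -> T -> R) : Prop :=
  forall (x : T) (A : set T),
    nbhs x A <-> exists2 e : R, 0 < e & [set y | d x y < e] `<=` A.

Definition complete_metric (d : T -> T -> R) : Prop :=
  forall u : nat -> T,
    (forall e : R, 0 < e -> exists N : nat,
      forall m n : nat, (N <= m)%N -> (N <= n)%N -> d (u m) (u n) < e) ->
    exists l : T, u @ \oo --> l.

(* Polishness is a property of the topology: when T is a metric space, its own
   metric is not required to be complete. *)
Definition polish_space : Prop :=
  separable_space /\
  exists d, [/\ metric_axioms d, induces_topology d & complete_metric d].

End Polish.

Notation borel T := (g_sigma_algebraType (@open T)).

(* This is the metric whose balls are those of the library's product
   pseudometric structure. *)
Definition prod_mdist (R : realType) (X Y : metricType R) (p q : X * Y) : R :=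
  Num.max (mdist p.1 q.1) (mdist p.2 q.2).

Definition lipschitz_prod (R : realType) (X Y : metricType R)
    (c : X * Y -> R) : Prop :=
  exists L : R, forall p q : X * Y, `|c p - c q| <= L * prod_mdist p q.

Definition bounded_continuous (R : realType) (T : topologicalType) :
    set (T -> R) :=
  [set f : T -> R | continuous f /\ bounded_fun (f : T -> R^o)].

Section Transport.
Context (R : realType) (X Y : pmetricType R).
Variables (mu : probability (borel X) R) (nu : probability (borel Y) R)
          (c : X * Y -> R).

(* The measures live on the Borel sets of the product topology. *)
Definition couplings : set (probability (borel (X * Y)%type) R) :=
  [set pi : probability (borel (X * Y)%type) R |
    (forall A : set (borel X), measurable A ->
       pushforward pi (fst : borel (X * Y)%type -> borel X) A = mu A) /\
    (forall B : set (borel Y), measurable B ->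
       pushforward pi (snd : borel (X * Y)%type -> borel Y) B = nu B)].

Definition transport_cost (pi : probability (borel (X * Y)%type) R) : \bar R :=
  (\int[pi]_p (c p)%:E)%E.

Definition admissible_pairs : set ((X -> R) * (Y -> R)) :=
  [set f | [/\ bounded_continuous f.1, bounded_continuous f.2 &
     forall (x : X) (y : Y), f.1 x - f.2 y <= c (x, y)]].

Definition dual_value (f : (X -> R) * (Y -> R)) : \bar R :=
  (\int[mu]_x (f.1 x)%:E - \int[nu]_y (f.2 y)%:E)%E.

End Transport.

(* Main.v *)
(* Let p(f) be the infimum of the integrals of phi + psi over bounded measurable
   phi, psi with f(x,y) <= phi(x) + psi(y), for f an arbitrary bounded function
   on X * Y.  By Hahn-Banach there is a linear functional L <= p with
   L(-c) = p(-c); it is positive, it has the marginals mu and nu, and L(c) is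
   the dual value.  The set function E |-> L(1_E) is only finitely additive, but
   since mu and nu are inner regular by compact sets and outer regular by open
   sets, so is L on rectangles; by compactness it is then sigma-additive on the
   ring of the regular sets and extends to a coupling pi.  As pi(G) <= L(1_G)
   for G open, slicing c into its superlevel sets gives that the integral of c
   against pi is at most L(c), whence duality and an optimal plan.

   For the dual problem, a limsup of a fast maximizing sequence is optimal among
   the measurable pairs, and its double c-transform is Lipschitz. *)

Require Import Defs.
From HB Require Import structures.
From mathcomp Require Import all_boot all_order all_algebra.
From mathcomp Require Import all_classical all_reals all_analysis.
From mathcomp Require Import finmap measurable_realfun lra.
Import Order.TTheory GRing.Theory Num.Theory.
Import numFieldNormedType.Exports.
Set Implicit Arguments.
Unset Strict Implicit.
Unset Printing Implicit Defensive.
Local Open Scope classical_set_scope.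
Local Open Scope ring_scope.

(** * Hahn-Banach for a sublinear function on a subspace *)

Section HahnBanach.
Context (R : realType) (V : lmodType R) (B : set V).
Hypothesis (BD : forall u v, B u -> B v -> B (u + v)).
Hypothesis (BZ : forall t u, B u -> B (t *: u)).

(** The subspace is a predicate [B], so that bounded functions can be treated inside the module of
    all functions. *)
Definition sublinear_on (q : V -> R) : Prop :=
  (forall u v, B u -> B v -> q (u + v) <= q u + q v) /\
  (forall t u, 0 < t -> B u -> q (t *: u) = t * q u).

(** The reverse inequality of homogeneity is the given one applied to [t^-1] and [t *: u]. *)
Lemma sublinear_onI q :
  (forall u v, B u -> B v -> q (u + v) <= q u + q v) ->
  (forall t u, 0 < t -> B u -> t * q u <= q (t *: u)) -> sublinear_on q.
Proof.
move=> qD qZ; split=> // t u t0 Bu; apply/le_anti; rewrite qZ // andbT.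
have ti : 0 < t^-1 by rewrite invr_gt0.
have := qZ _ _ ti (BZ t Bu); rewrite scalerA mulVf ?gt_eqF// scale1r.
by rewrite -(ler_pM2l t0) mulrA mulfV ?gt_eqF// mul1r.
Qed.

Lemma sublinear_on0 q : sublinear_on q -> B 0 -> q 0 = 0.
Proof.
move=> [_ qZ] B0; have := qZ 2 0 (ltr0n _ 2) B0.
by rewrite scaler0; lra.
Qed.

Lemma sublinear_onN q u : sublinear_on q -> B u -> - q (- u) <= q u.
Proof.
move=> qs Bu; have BNu : B (- u) by rewrite -scaleN1r; exact: BZ.
have B0 : B 0 by rewrite -(subrr u); exact: BD.
by have := qs.1 _ _ Bu BNu; rewrite subrr (sublinear_on0 qs B0); lra.
Qed.

(** The standard sublinear minorant of [q] in the Hahn-Banach argument: at [- v] it is at most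
    [- q v], which forces equality with [q] at [v] for a linear function below it. *)
Definition directional_inf (q : V -> R) (v u : V) : R :=
  inf [set q (u + t *: v) - t * q v | t in [set t | 0 <= t]].

Lemma directional_inf_has_inf q v u : sublinear_on q -> B v -> B u ->
  has_inf [set q (u + t *: v) - t * q v | t in [set t | 0 <= t]].
Proof.
move=> qs Bv Bu; split; first by exists (q (u + 0 *: v) - 0 * q v); exists 0 => //=.
exists (- q (- u)) => _ [t /= t0 <-].
have BNu : B (- u) by rewrite -scaleN1r; exact: BZ.
have [->|tn0] := eqVneq t 0.
  by rewrite scale0r addr0 mul0r subr0; exact: sublinear_onN.
have {tn0}t0 : 0 < t by rewrite lt_neqAle eq_sym tn0.
rewrite lerBrDr -(qs.2 _ _ t0 Bv).
have := qs.1 _ _ (BD Bu (BZ t Bv)) BNu.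
by rewrite (addrC u) addrK; lra.
Qed.

Lemma directional_inf_le q v u t : sublinear_on q -> B v -> B u -> 0 <= t ->
  directional_inf q v u <= q (u + t *: v) - t * q v.
Proof.
move=> qs Bv Bu t0; apply: ge_inf; last by exists t.
by have [_] := directional_inf_has_inf qs Bv Bu.
Qed.

Lemma directional_inf_lt q v u e : sublinear_on q -> B v -> B u -> 0 < e ->
  exists2 t, 0 <= t & q (u + t *: v) - t * q v < directional_inf q v u + e.
Proof.
move=> qs Bv Bu e0.
have [_ [t t0 <-] ?] := inf_adherent e0 (directional_inf_has_inf qs Bv Bu).
by exists t.
Qed.

(** Near-optimal parameters for [u] and [w] add up to a parameter for [u + w]; scaling by [t]
    replaces [s] by [s / t]. *)
Lemma directional_inf_sublinear q v : sublinear_on q -> B v ->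
  sublinear_on (directional_inf q v).
Proof.
move=> qs Bv; apply: sublinear_onI => [u w Bu Bw|t u t0 Bu].
  apply/ler_addgt0Pr => e e0; have e20 : 0 < e / 2 by rewrite divr_gt0.
  have [s s0 Hs] := directional_inf_lt qs Bv Bu e20.
  have [t t0 Ht] := directional_inf_lt qs Bv Bw e20.
  have /le_trans := directional_inf_le qs Bv (BD Bu Bw) (addr_ge0 s0 t0); apply.
  have := qs.1 _ _ (BD Bu (BZ s Bv)) (BD Bw (BZ t Bv)).
  by rewrite scalerDl addrACA; lra.
apply: lb_le_inf.
  by have [] := directional_inf_has_inf qs Bv (BZ t Bu).
move=> _ [s /= s0 <-].
have st : 0 <= s / t by rewrite divr_ge0 // ltW.
have := directional_inf_le qs Bv Bu st.
rewrite -(ler_pM2l t0) => /le_trans; apply.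
rewrite mulrBr -(qs.2 _ _ t0); last exact: BD Bu (BZ _ Bv).
have ts : t * (s / t) = s by rewrite mulrCA mulfV ?gt_eqF// mulr1.
by rewrite scalerDr scalerA ts mulrA ts.
Qed.

Lemma directional_inf_le_id q v u : sublinear_on q -> B v -> B u ->
  directional_inf q v u <= q u.
Proof.
move=> qs Bv Bu; have := directional_inf_le qs Bv Bu (lexx 0).
by rewrite scale0r addr0 mul0r subr0.
Qed.

(** Zorn's lemma for the reversed pointwise order. The common lower bound [- q (- u)] keeps the
    infimum of a chain finite. *)
Lemma minimal_sublinear q : sublinear_on q ->
  exists m, [/\ sublinear_on m, forall u, B u -> m u <= q u &
    forall m', sublinear_on m' -> (forall u, B u -> m' u <= m u) ->
      forall u, B u -> m u <= m' u].
Proof.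
move=> qs.
pose S := {m : V -> R | sublinear_on m /\ forall u, B u -> m u <= q u}.
pose le (m m' : S) := `[< forall u, B u -> sval m' u <= sval m u >].
have q0 : sublinear_on q /\ forall u, B u -> q u <= q u by [].
have [| | |m mmax] := @ZL_preorder S (exist _ q q0) le.
- by move=> m; apply/asboolP.
- move=> m1 m2 m3 /asboolP h1 /asboolP h2; apply/asboolP => u Bu.
  exact: le_trans (h2 u Bu) (h1 u Bu).
- move=> A Atot; have [[m0 Am0]|A0] := pselect (A !=set0); last first.
    by exists (exist _ q q0) => s As; exfalso; apply: A0; exists s.
  pose i u := inf [set sval m u | m in A].
  have hi u : B u -> has_inf [set sval m u | m in A].
    move=> Bu; split; first by exists (sval m0 u), m0.
    exists (- q (- u)) => _ [m Am <-]; have [ms mq] := svalP m.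
    have BNu : B (- u) by rewrite -scaleN1r; exact: BZ.
    by rewrite (le_trans _ (sublinear_onN ms Bu))// lerN2 mq.
  have ile m u : A m -> B u -> i u <= sval m u.
    by move=> Am Bu; apply: ge_inf; [have [] := hi _ Bu|exists m].
  have ilt u e : B u -> 0 < e -> exists2 m, A m & sval m u < i u + e.
    by move=> Bu e0; have [_ [m Am <-]] := inf_adherent e0 (hi _ Bu); exists m.
  have is_ : sublinear_on i.
    apply: sublinear_onI => [u v Bu Bv|t u t0 Bu].
      apply/ler_addgt0Pr => e e0; have e20 : 0 < e / 2 by rewrite divr_gt0.
      have [m1 Am1 h1] := ilt _ _ Bu e20; have [m2 Am2 h2] := ilt _ _ Bv e20.
      (* Of two members of a chain, the pointwise smaller one serves for both [u] and [v]. *)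
      have [m [Am l1 l2]] : exists m, [/\ A m, sval m u <= sval m1 u &
          sval m v <= sval m2 v].
        case: (Atot _ _ Am1 Am2) => /asboolP h.
          by exists m2; split => //; exact: h.
        by exists m1; split => //; exact: h.
      apply: (le_trans (ile _ _ Am (BD Bu Bv))).
      by have := (svalP m).1.1 _ _ Bu Bv; lra.
    apply: lb_le_inf; first by have [] := hi _ (BZ t Bu).
    move=> _ [m Am <-]; rewrite ((svalP m).1.2 _ _ t0 Bu).
    by rewrite ler_pM2l // ile.
  have iq : sublinear_on i /\ forall u, B u -> i u <= q u.
    split => // u Bu; exact: le_trans (ile _ _ Am0 Bu) ((svalP m0).2 _ Bu).
  exists (exist _ i iq) => m Am; apply/asboolP => u Bu /=; exact: ile.
exists (sval m); have [ms mq] := svalP m; split => // m' m's m'm u Bu.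
have m'q : sublinear_on m' /\ forall u, B u -> m' u <= q u.
  by split => // w Bw; exact: le_trans (m'm _ Bw) (mq _ Bw).
have /asboolP := mmax (exist _ m' m'q) (asboolT m'm); exact.
Qed.

(** [L] is a minimal sublinear function below [directional_inf p v0]. By minimality [L] lies below
    [directional_inf L v] for each [v] in [B], and the term [t = 1] of that infimum gives
    superadditivity. *)
Theorem hahn_banach (p : V -> R) (v0 : V) : sublinear_on p -> B v0 ->
  exists L : V -> R, [/\ forall u v, B u -> B v -> L (u + v) = L u + L v,
    forall t u, B u -> L (t *: u) = t * L u,
    forall u, B u -> L u <= p u & L v0 = p v0].
Proof.
move=> ps Bv0.
have BN u : B u -> B (- u) by move=> Bu; rewrite -scaleN1r; exact: BZ.
have B0 : B 0 by rewrite -(subrr v0); apply: BD => //; exact: BN.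
have [L [Ls Lq Lmin]] := minimal_sublinear (directional_inf_sublinear ps Bv0).
have Lp u : B u -> L u <= p u.
  by move=> Bu; exact: le_trans (Lq _ Bu) (directional_inf_le_id ps Bv0 Bu).
have LD u v : B u -> B v -> L (u + v) = L u + L v.
  move=> Bu Bv; apply/le_anti; rewrite Ls.1 //=.
  have := Lmin _ (directional_inf_sublinear Ls Bv)
    (fun w => directional_inf_le_id Ls Bv) _ Bu.
  have := directional_inf_le Ls Bv Bu ler01.
  by rewrite scale1r mul1r; lra.
have LN u : B u -> L (- u) = - L u.
  move=> Bu; have := LD _ _ Bu (BN _ Bu).
  by rewrite subrr (sublinear_on0 Ls B0); lra.
exists L; split => //.
- move=> t u Bu; have [t0|t0|->] := ltgtP t 0; last first.
  + by rewrite scale0r mul0r (sublinear_on0 Ls B0).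
  + exact: Ls.2.
  + rewrite -[t]opprK scaleNr LN; last exact: BZ.
    by rewrite Ls.2 // ?mulNr// oppr_gt0.
(* [L (- v0)] is at most the directional infimum at [- v0], whose term [t = 1] equals [- p v0]. *)
apply/le_anti; rewrite Lp //=.
have := Lq _ (BN _ Bv0).
have := directional_inf_le ps Bv0 (BN _ Bv0) ler01.
rewrite scale1r mul1r addNr (sublinear_on0 ps B0) LN //.
by lra.
Qed.

End HahnBanach.

(** * The functional with prescribed marginals *)

(** Measurability is not asked, so that the functional acts on the indicator of every set. *)
Definition bounded_by_cst (R : realType) (T : Type) : set (T -> R) :=
  [set f | exists M, forall x, `|f x| <= M].

Definition bounded_measurable (R : realType) d (T : measurableType d) :
    set (T -> R) :=
  [set f | measurable_fun setT f /\ bounded_by_cst f].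

Section BoundedFunctions.
Context (R : realType).

Lemma bounded_by_cstD (T : Type) (f g : T -> R) :
  bounded_by_cst f -> bounded_by_cst g -> bounded_by_cst (f + g).
Proof.
move=> [M fM] [N gN]; exists (M + N) => x.
by rewrite (le_trans (ler_normD _ _))// lerD.
Qed.

Lemma bounded_by_cstZ (T : Type) t (f : T -> R) :
  bounded_by_cst f -> bounded_by_cst (t *: f).
Proof.
by move=> [M fM]; exists (`|t| * M) => x; rewrite normrM ler_wpM2l.
Qed.

Lemma bounded_by_cst_indic (T : Type) (A : set T) : bounded_by_cst (\1_A : T -> R).
Proof.
by exists 1 => x; rewrite indicE; case: (_ \in _); rewrite ?normr1 ?normr0.
Qed.

Context d (T : measurableType d).
Implicit Types f g : T -> R.

Lemma bounded_measurableD f g :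
  bounded_measurable f -> bounded_measurable g -> bounded_measurable (f \+ g).
Proof.
by move=> [mf bf] [mg bg]; split; [exact: measurable_funD|exact: bounded_by_cstD].
Qed.

Lemma bounded_measurableZ t f :
  bounded_measurable f -> bounded_measurable (fun x => t * f x).
Proof.
move=> [mf bf]; split; last exact: bounded_by_cstZ.
by apply: measurable_funM => //; exact: measurable_cst.
Qed.

Lemma bounded_measurableN f : bounded_measurable f -> bounded_measurable (\- f).
Proof.
move=> /(bounded_measurableZ (-1)); congr (bounded_measurable _).
by apply/funext => x; rewrite mulN1r.
Qed.

Lemma bounded_measurable_cst r : bounded_measurable (cst r : T -> R).
Proof. by split; [exact: measurable_cst|exists `|r|]. Qed.

Lemma bounded_measurable_indic (A : set T) : measurable A ->
  bounded_measurable (\1_A : T -> R).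
Proof.
by move=> mA; split; [exact: measurable_indic|exact: bounded_by_cst_indic].
Qed.

Context (P : probability T R).

Lemma bounded_measurable_integrable f : bounded_measurable f ->
  P.-integrable setT (EFin \o f).
Proof.
move=> [mf [M fM]]; apply: measurable_bounded_integrable => //.
  by have : (P setT < +oo)%E by rewrite probability_setT ltry.
exists M; split; first exact: num_real.
by move=> y My x _; exact: le_trans (fM x) (ltW My).
Qed.

Lemma Rexpectation_cst r : \int[P]_x (cst r x : R) = r.
Proof.
have -> : \int[P]_x (cst r x : R) = r * fine (P setT) by exact: Rintegral_cst.
by rewrite probability_setT mulr1.
Qed.

Lemma Rexpectation_indic (A : set T) : measurable A ->
  \int[P]_x (\1_A x : R) = fine (P A).
Proof. by move=> mA; rewrite /Rintegral integral_indic// setIT. Qed.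

Lemma RexpectationD f g : bounded_measurable f -> bounded_measurable g ->
  \int[P]_x (f x + g x) = \int[P]_x f x + \int[P]_x g x.
Proof.
by move=> bf bg; apply: RintegralD => //; exact: bounded_measurable_integrable.
Qed.

Lemma RexpectationZ t f : bounded_measurable f ->
  \int[P]_x (t * f x) = t * \int[P]_x f x.
Proof.
by move=> bf; apply: RintegralZl => //; exact: bounded_measurable_integrable.
Qed.

Lemma RexpectationN f : bounded_measurable f ->
  \int[P]_x (- f x) = - \int[P]_x f x.
Proof.
move=> bf; rewrite -[RHS]mulN1r -RexpectationZ//.
by apply: eq_Rintegral => x _; rewrite mulN1r.
Qed.

Lemma le_Rexpectation f g : bounded_measurable f -> bounded_measurable g ->
  (forall x, f x <= g x) -> \int[P]_x f x <= \int[P]_x g x.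
Proof.
by move=> bf bg fg; apply: le_Rintegral => //; exact: bounded_measurable_integrable.
Qed.

Lemma EFin_Rexpectation f : bounded_measurable f ->
  (\int[P]_x (f x)%:E)%E = (\int[P]_x f x)%:E.
Proof.
move=> bf; rewrite /Rintegral fineK//.
exact/integrable_fin_num/bounded_measurable_integrable.
Qed.

End BoundedFunctions.

(** * The superhedging bound and a linear functional below it *)

Section MarginalFunctional.
Context (R : realType) d1 d2 (T1 : measurableType d1) (T2 : measurableType d2).
Context (P1 : probability T1 R) (P2 : probability T2 R).

Definition superhedging_prices (f : T1 * T2 -> R) : set R :=
  [set r | exists phi psi, [/\ bounded_measurable phi, bounded_measurable psi,
     forall x y, f (x, y) <= phi x + psi y &
     r = \int[P1]_x phi x + \int[P2]_y psi y]].

(** The bound is integrated in one variable at a time, so no product measure is involved. *)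
Lemma superhedging_prices_ge f M r : (forall z, M <= f z) ->
  superhedging_prices f r -> M <= r.
Proof.
move=> Mf [phi [psi [bphi bpsi fle ->]]].
rewrite -lerBlDr -(Rexpectation_cst P1 (M - _)).
apply: le_Rexpectation => [|//|x]; first exact: bounded_measurable_cst.
rewrite /cst lerBlDr -lerBlDl -(Rexpectation_cst P2 (M - _)).
apply: le_Rexpectation => [|//|y]; first exact: bounded_measurable_cst.
by rewrite /cst lerBlDl (le_trans (Mf (x, y))).
Qed.

Lemma superhedging_prices_has_inf f : bounded_by_cst f ->
  has_inf (superhedging_prices f).
Proof.
move=> [M fM]; split; last first.
  exists (- M) => r; apply: superhedging_prices_ge => z.
  by have := fM z; rewrite ler_norml => /andP[].
exists (M + 0), (cst M), (cst 0).
split; try exact: bounded_measurable_cst; last by rewrite !Rexpectation_cst.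
by move=> x y; rewrite /cst addr0 (le_trans (ler_norm _)).
Qed.

(** Dominating pairs can be added and rescaled by positive factors, and their prices follow. *)
Lemma inf_superhedging_prices_sublinear :
  sublinear_on (@bounded_by_cst R _) (fun f => inf (superhedging_prices f)).
Proof.
apply: (sublinear_onI (@bounded_by_cstZ R _)) => [f g bf bg|t f t0 bf].
  apply/ler_addgt0Pr => e e0; have e20 : 0 < e / 2 by rewrite divr_gt0.
  have [_ [p1 [q1 [bp1 bq1 h1 ->]]] l1] :=
    inf_adherent e20 (superhedging_prices_has_inf bf).
  have [_ [p2 [q2 [bp2 bq2 h2 ->]]] l2] :=
    inf_adherent e20 (superhedging_prices_has_inf bg).
  apply: (@le_trans _ _ (\int[P1]_x p1 x + \int[P2]_y q1 y +
    (\int[P1]_x p2 x + \int[P2]_y q2 y))); last by lra.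
  apply: ge_inf.
    by have [] := superhedging_prices_has_inf (bounded_by_cstD bf bg).
  exists (p1 \+ p2), (q1 \+ q2); split.
  - exact: bounded_measurableD.
  - exact: bounded_measurableD.
  - by move=> x y; rewrite /= addrACA lerD.
  - by rewrite !RexpectationD// addrACA.
apply: lb_le_inf.
  by have [] := superhedging_prices_has_inf (bounded_by_cstZ t bf).
move=> _ [p [q [bp bq h ->]]].
rewrite -ler_pdivlMl// mulrDr -!RexpectationZ//.
apply: ge_inf; first by have [] := superhedging_prices_has_inf bf.
exists (fun x => t^-1 * p x), (fun y => t^-1 * q y); split => //.
- exact: bounded_measurableZ.
- exact: bounded_measurableZ.
- by move=> x y; rewrite -mulrDr ler_pdivlMl//; exact: h.
Qed.

(** Hahn-Banach at [- c]. For positivity, the zero pair dominates [- f]. For the marginals,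
    [phi + psi] and its negative are each dominated by themselves at their own price. For the last
    clause, a pair [(p, q)] dominating [- c] gives the dual pair [(- p, q)]. *)
Lemma marginal_functional (c : T1 * T2 -> R) : bounded_by_cst c ->
  exists L : (T1 * T2 -> R) -> R,
  [/\ forall f g, bounded_by_cst f -> bounded_by_cst g -> L (f \+ g) = L f + L g,
      forall t f, bounded_by_cst f -> L (fun z => t * f z) = t * L f,
      forall f, bounded_by_cst f -> (forall z, 0 <= f z) -> 0 <= L f,
      forall phi psi, bounded_measurable phi -> bounded_measurable psi ->
        L (fun z => phi z.1 + psi z.2) = \int[P1]_x phi x + \int[P2]_y psi y &
      forall D, (forall phi psi, bounded_measurable phi ->
          bounded_measurable psi -> (forall x y, phi x - psi y <= c (x, y)) ->
          \int[P1]_x phi x - \int[P2]_y psi y <= D) -> L c <= D].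
Proof.
move=> bc; have bNc : bounded_by_cst (- c).
  by rewrite -scaleN1r; exact: bounded_by_cstZ.
have [L [LD LZ Lp Lc]] := hahn_banach (@bounded_by_cstD R _) (@bounded_by_cstZ R _)
  inf_superhedging_prices_sublinear bNc.
have L_le f p q : bounded_by_cst f -> bounded_measurable p ->
    bounded_measurable q -> (forall x y, f (x, y) <= p x + q y) ->
    L f <= \int[P1]_x p x + \int[P2]_y q y.
  move=> bf bp bq h; apply: (le_trans (Lp _ bf)).
  by apply: ge_inf; [have [] := superhedging_prices_has_inf bf|exists p, q].
have LN f : bounded_by_cst f -> L (- f) = - L f.
  by move=> bf; rewrite -scaleN1r LZ// mulN1r.
have bN (f : T1 * T2 -> R) : bounded_by_cst f -> bounded_by_cst (- f).
  by move=> bf; rewrite -scaleN1r; exact: bounded_by_cstZ.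
exists L; split => //.
- move=> f bf f0; rewrite -oppr_le0 -LN//.
  have b0 d (T : measurableType d) : bounded_measurable (cst 0 : T -> R).
    exact: bounded_measurable_cst.
  have := L_le _ _ _ (bN _ bf) (b0 _ _) (b0 _ _).
  rewrite !Rexpectation_cst addr0; apply => x y.
  by rewrite oppr_le0.
- move=> p q bp bq; have bpq : bounded_by_cst (fun z : T1 * T2 => p z.1 + q z.2).
    have [[_ [M pM]] [_ [N qN]]] := (bp, bq); exists (M + N) => z.
    by rewrite (le_trans (ler_normD _ _))// lerD.
  apply/le_anti; rewrite L_le//= -lerN2 -LN// [leRHS]opprD -!RexpectationN//.
  apply: L_le; [exact: bN|exact: bounded_measurableN|exact: bounded_measurableN|].
  by move=> x y; rewrite -opprD.
- move=> D HD; rewrite -lerN2 -LN// Lc; apply: lb_le_inf.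
    by have [] := superhedging_prices_has_inf bNc.
  move=> _ [p [q [bp bq h ->]]].
  have := HD _ _ (bounded_measurableN bp) bq.
  rewrite RexpectationN// -opprD lerNl; apply => x y.
  by rewrite -opprD lerNl; exact: h.
Qed.

End MarginalFunctional.

(** * Countably additive extension of regular finitely additive set functions *)

Record fin_additive (R : realType) (T : Type) := FinAdditive {
  fin_additive_fun :> set T -> R;
  fin_additive_ge0 : forall A, 0 <= fin_additive_fun A;
  fin_additiveU : forall A B, A `&` B = set0 ->
    fin_additive_fun (A `|` B) = fin_additive_fun A + fin_additive_fun B }.

Section FinAdditive.
Context (R : realType) (T : Type) (P : fin_additive R T).
Implicit Types A B : set T.

Lemma fin_additive0 : P set0 = 0.
Proof. by have := fin_additiveU P (setI0 set0); rewrite setU0; lra. Qed.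

Lemma fin_additive_setD A B : A `<=` B -> P B = P A + P (B `\` A).
Proof. by move=> AB; rewrite -fin_additiveU ?setDIK// setDUK. Qed.

Lemma le_fin_additive A B : A `<=` B -> P A <= P B.
Proof. by move=> AB; rewrite (fin_additive_setD AB) lerDl fin_additive_ge0. Qed.

Lemma fin_additive_leU A B : P (A `|` B) <= P A + P B.
Proof.
rewrite (fin_additive_setD (@subsetUl _ A B)) lerD2l le_fin_additive//.
by move=> x [[]].
Qed.

Lemma fin_additive_le_bigU (F : nat -> set T) n :
  P (\big[setU/set0]_(i < n) F i) <= \sum_(i < n) P (F i).
Proof.
elim: n => [|n ih]; first by rewrite !big_ord0 fin_additive0.
by rewrite !big_ord_recr /= (le_trans (fin_additive_leU _ _))// lerD2r.
Qed.

End FinAdditive.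

(** [K] is asked to be closed as well, since [T] need not be Hausdorff and [U] minus a compact set
    must be open. Smallness of [U] minus [K] expresses inner and outer regularity at once. *)
Definition compact_open_regular (R : realType) (T : topologicalType)
    (P : fin_additive R T) : set (set T) :=
  [set E | forall e, 0 < e -> exists K U,
    [/\ compact K, closed K, open U, K `<=` E /\ E `<=` U & P (U `\` K) < e]].

(* An alias of [T], on which the regular sets of [P] are the measurable sets. *)
Definition regular_sets (R : realType) (T : ptopologicalType)
  (P : fin_additive R T) : Type := T.

Section RegularSets.
Context (R : realType) (T : ptopologicalType) (P : fin_additive R T).
Local Notation reg := (compact_open_regular P).

Lemma compact_open_regular0 : reg set0.
Proof.
move=> e e0; exists set0, set0; split => //.
- exact: compact0.
- exact: closed0.
- exact: open0.
- by split.
- by rewrite setD0 fin_additive0.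
Qed.

Lemma compact_open_regularU : setU_closed reg.
Proof.
move=> A B rA rB e e0; have e20 : 0 < e / 2 by rewrite divr_gt0.
have [K1 [U1 [cK1 dK1 oU1 [KA AU] P1]]] := rA _ e20.
have [K2 [U2 [cK2 dK2 oU2 [KB BU] P2]]] := rB _ e20.
exists (K1 `|` K2), (U1 `|` U2); split.
- exact: compactU.
- exact: closedU.
- exact: openU.
- by split; exact: setUSS.
rewrite (@le_lt_trans _ _ (P (U1 `\` K1) + P (U2 `\` K2)))//; last by lra.
rewrite (le_trans _ (fin_additive_leU _ _ _))// le_fin_additive// => x.
by move=> [[Ux|Ux] /not_orP[n1 n2]]; [left|right].
Qed.

(** The roles cross: the compact part of [A] loses the open neighbourhood of [B], the open part of
    [A] loses the compact part of [B]. *)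
Lemma compact_open_regularD : setD_closed reg.
Proof.
move=> A B rA rB e e0; have e20 : 0 < e / 2 by rewrite divr_gt0.
have [K1 [U1 [cK1 dK1 oU1 [KA AU] P1]]] := rA _ e20.
have [K2 [U2 [cK2 dK2 oU2 [KB BU] P2]]] := rB _ e20.
exists (K1 `\` U2), (U1 `\` K2); split.
- by rewrite setDE; apply: compact_closedI => //; exact: open_closedC.
- by rewrite setDE; apply: closedI => //; exact: open_closedC.
- by rewrite setDE; apply: openI => //; exact: closed_openC.
- by split; apply: setDSS.
rewrite (@le_lt_trans _ _ (P (U1 `\` K1) + P (U2 `\` K2)))//; last by lra.
rewrite (le_trans _ (fin_additive_leU _ _ _))// le_fin_additive// => x.
move=> [[Ux nKx] /not_andP[nx|/contrapT xU]]; first by left.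
by right.
Qed.

(** Opaque, so that the ring of regular sets has a display kept apart from the default one. *)
Definition regular_sets_display : measure_display.
Proof. exact: default_measure_display. Qed.

HB.instance Definition _ := Pointed.on (regular_sets P).
HB.instance Definition _ := @isRingOfSets.Build regular_sets_display
  (regular_sets P) reg compact_open_regular0 compact_open_regularU
  compact_open_regularD.

Definition fin_additive_ext (E : set (regular_sets P)) : \bar R := (P E)%:E.

Lemma fin_additive_ext_ge0 E : (0 <= fin_additive_ext E)%E.
Proof. by rewrite lee_fin fin_additive_ge0. Qed.

Lemma fin_additive_ext_semi_additive :
  measure_function.semi_additive fin_additive_ext.
Proof.
move=> F n _ tF _; elim: n => [|n ih].
  by rewrite !big_ord0 /fin_additive_ext fin_additive0.
rewrite !big_ord_recr/= -ih -EFinD /fin_additive_ext fin_additiveU//.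
rewrite -bigcup_mkord setI_bigcupl bigcup0// => i /= ni.
by move/trivIsetP : tF; apply => //; rewrite ltn_eqF.
Qed.

HB.instance Definition _ := isContent.Build _ _ _ fin_additive_ext
  fin_additive_ext_ge0 fin_additive_ext_semi_additive.

(** Alexandrov's argument: a compact subset nearly exhausting [A] is covered by open sets slightly
    larger than the [F n], and a finite subcover reduces the claim to finite subadditivity. *)
Lemma fin_additive_ext_sigma_subadditive :
  measurable_subset_sigma_subadditive fin_additive_ext.
Proof.
move=> A F mF mA AF; apply/lee_addgt0Pr => e e0.
have e20 : 0 < e / 2 by rewrite divr_gt0.
have [K [V [cK _ oV [KA AV] PVK]]] := mA _ e20.
(* The enlargements cost [e / 2] in total; the other half pays for [A] minus [K]. *)
have /choice[U HU] n : exists U, [/\ open U, F n `<=` U &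
    P U <= P (F n) + e / 2 / (2 ^ n.+1)%:R].
  have en0 : 0 < e / 2 / (2 ^ n.+1)%:R by rewrite divr_gt0// ltr0n expn_gt0.
  have [L [U [_ _ oU [LF FU] PUL]]] := mF n _ en0; exists U; split => //.
  rewrite (fin_additive_setD P (subset_trans LF FU)).
  by rewrite lerD ?le_fin_additive// ltW.
have oU i : setT i -> open (U i) by have [] := HU i.
move: cK; rewrite compact_cover => /(_ _ _ _ oU)[|D _ KD].
  by move=> x /KA /AF [n _ Fnx]; exists n => //; have [_ + _] := HU n; exact.
(* All indices of the finite subcover lie below [N], so an initial segment covers [K]. *)
pose N := (\max_(i <- D) i).+1.
have KN : K `<=` \big[setU/set0]_(i < N) U i.
  move=> x /KD [i /= iD Uix]; rewrite -bigcup_mkord; exists i => //=.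
  rewrite ltnS. by apply: (leq_bigmax_seq (F := id)) iD _.
have PA : P A <= \sum_(i < N) (P (F i) + e / 2 / (2 ^ i.+1)%:R) + e / 2.
  rewrite (fin_additive_setD P KA) lerD//.
    rewrite (le_trans (le_fin_additive P KN))//.
    rewrite (le_trans (fin_additive_le_bigU _ _ _))//.
    by apply: ler_sum => i _; have [] := HU i.
  by rewrite (le_trans (le_fin_additive P (@setSD _ K _ _ AV)))// ltW.
have ge0 n : (0 <= fin_additive_ext (F n) + (e / 2 / (2 ^ n.+1)%:R)%:E)%E.
  by rewrite adde_ge0 ?fin_additive_ext_ge0// lee_fin divr_ge0// ltW.
rewrite [e]splitr EFinD addeA.
apply: le_trans (leeD2r (e / 2)%:E
  (epsilon_trick xpredT (fun n => fin_additive_ext_ge0 (F n)) (ltW e20))).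
have := @nneseries_lim_ge _ _ xpredT 0 N (fun n _ _ => ge0 n).
move=> /(leeD2r (e / 2)%:E); apply: le_trans.
rewrite big_mkord (eq_bigr (fun i : 'I_N =>
  (P (F i) + e / 2 / (2 ^ i.+1)%:R)%:E))//.
by rewrite sumEFin -EFinD lee_fin.
Qed.

HB.instance Definition _ := Content_SigmaSubAdditive_isMeasure.Build _ _ _
  fin_additive_ext fin_additive_ext_sigma_subadditive.

(** The Caratheodory extension is countably additive on the sigma-algebra generated by the regular
    sets, which contains the Borel sets; the measure is its restriction. *)
Lemma regular_sets_extension : @open T `<=` <<s reg >> -> reg setT -> P setT = 1 ->
  exists m : probability (g_sigma_algebraType (@open T)) R,
  forall E, reg E -> m E = (P E)%:E.
Proof.
move=> open_reg regT PT.
have borel_reg : <<s @open T >> `<=` <<s reg >>.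
  by apply: smallest_sub => //; exact: smallest_sigma_algebra.
have mE E : reg E -> measure_extension fin_additive_ext E = (P E)%:E.
  by move=> rE; exact: (measurable_mu_extE fin_additive_ext).
pose m : set (g_sigma_algebraType (@open T)) -> \bar R :=
  measure_extension fin_additive_ext.
have m0 : m set0 = 0%E by rewrite /m measure0.
have m_ge0 E : (0 <= m E)%E.
  exact: (measure_ge0 (measure_extension fin_additive_ext)).
have m_additive : semi_sigma_additive m.
  move=> F mF tF mUF.
  apply: (@measure_semi_sigma_additive _ _ _ (measure_extension fin_additive_ext)).
  - by move=> i; exact: (borel_reg _ (mF i)).
  - by [].
  - exact: (borel_reg _ mUF).
have mT : m setT = 1%E by rewrite /m mE// PT.
pose mm := isMeasure.Build _ _ _ m m0 m_ge0 m_additive.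
pose mu : {measure set (g_sigma_algebraType (@open T)) -> \bar R} := HB.pack m mm.
pose mp := Measure_isProbability.Build _ _ R mu mT.
pose pr : probability (g_sigma_algebraType (@open T)) R := HB.pack m mm mp.
by exists pr.
Qed.

End RegularSets.

(** * Regularity of Borel probabilities *)

(** Separability by a dense sequence, in a form that passes directly to products. *)
Definition meets_balls (R : realType) (T : pseudoMetricType R) (s : nat -> T) :=
  forall x e, 0 < e -> exists n, ball x e (s n).

Lemma separable_meets_balls (R : realType) (T : pseudoPMetricType R) :
  separable_space T -> exists s : nat -> T, meets_balls s.
Proof.
move=> [D cD dD].
have ballD (x : T) (e : R) : 0 < e -> ball x e `&` D !=set0.
  move=> e0; have [ox xx] := open_nbhs_ball x (PosNum e0).
  have [|y [By Dy]] := dD _ _ ox; first by exists x.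
  by exists y; split => //; exact: interior_subset By.
case/pfcard_geP : cD => [D0|[s]].
  by have [y [_]] := ballD point 1 ltr01; rewrite D0.
exists s => x e e0; have [y [xy Dy]] := ballD x e e0.
have [n _ sn] := @surj _ _ _ _ s _ Dy; by exists n; rewrite sn.
Qed.

Lemma meets_balls_pair (R : realType) (T U : pseudoMetricType R)
    (s : nat -> T) (t : nat -> U) :
  meets_balls s -> meets_balls t ->
  exists r : nat -> T * U, meets_balls r.
Proof.
move=> ds dt; exists (fun n =>
  (* Codes of no pair get the harmless default [(0, 0)]. *)
  let: (i, j) := odflt (0, 0)%N (choice.unpickle n) in (s i, t j)).
move=> [x y] e e0; have [i xi] := ds x e e0; have [j yj] := dt y e e0.
by exists (choice.pickle (i, j)); rewrite choice.pickleK.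
Qed.

(** A Lindelof property: the balls of radius [1 / (k + 1)] around the dense sequence that satisfy
    [Q] already cover [A]. The remaining indices give the empty set, for which [Q] is not
    claimed. *)
Lemma countable_ball_cover (R : realType) (T : pseudoMetricType R) (s : nat -> T)
    (Q : set (set T)) (A : set T) : meets_balls s ->
  (forall B C, B `<=` C -> Q C -> Q B) ->
  (forall x, A x -> exists2 e, 0 < e & Q (ball x e)) ->
  exists B : nat -> set T,
    [/\ A `<=` \bigcup_n B n, forall n, B n !=set0 -> Q (B n) &
        forall n, B n = set0 \/ exists x e, B n = ball x e].
Proof.
move=> ds Qsub QA; pose b (p : nat * nat) := ball (s p.1) (p.2.+1%:R^-1 : R).
pose B n := if choice.unpickle n is Some p then
  if `[< Q (b p) >] then b p else set0 else set0.
exists B; split=> [x Ax|n|n].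
- have [e e0 Qe] := QA _ Ax; have e20 : 0 < e / 2 by rewrite divr_gt0.
  have [m me] := ltr_add_invr (R := R) (y := 0) (x := e / 2) e20.
  have m0 : 0 < m.+1%:R^-1 :> R by rewrite invr_gt0.
  have [i xi] := ds x _ m0.
  have Qb : Q (b (i, m)).
    (* Centre and radius are both within [e / 2], so this ball lies in the ball of radius [e] around
       [x]. *)
    apply: Qsub Qe => y; rewrite /b /= => iy.
    apply: (le_ball _ (ball_triangle xi iy)).
    by rewrite add0r in me; rewrite [leRHS]splitr lerD// ltW.
  exists (choice.pickle (i, m)) => //; rewrite /B choice.pickleK asboolT//.
  exact: ball_sym.
- rewrite /B; case: choice.unpickle => [p|[]//]; case: asboolP => // _ [] //.
- rewrite /B; case: choice.unpickle => [p|]; last by left.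
  by case: asboolP => _; [right; exists (s p.1), p.2.+1%:R^-1|left].
Qed.

(** Balls of a general pseudometric structure are only neighbourhoods; openness comes from the
    distance [mdist]. *)
Lemma open_metric_ball (R : realType) (T : metricType R) (x : T) (e : R) :
  open (ball x e).
Proof.
rewrite openE => y; rewrite ballEmdist /= => xy.
apply/nbhs_ballP; exists (e - mdist x y); first by rewrite /= subr_gt0.
move=> z; rewrite !ballEmdist/= => yz.
by rewrite (le_lt_trans (metric_triangle x y z))// -ltrBrDl.
Qed.

Section BorelSets.
Context (T : ptopologicalType).

Lemma borel_open (U : set (borel T)) : @open T U -> measurable U.
Proof. exact: sub_sigma_algebra. Qed.

Lemma borel_closed (F : set (borel T)) : @closed T F -> measurable F.
Proof.
move=> cF; rewrite -(setCK F); apply: measurableC; apply: borel_open.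
exact: closed_openC.
Qed.

End BorelSets.

Lemma measure_bigcup_tail d (T : measurableType d) (R : realType)
    (P : probability T R) (K : nat -> set T) (e : R) :
  (forall n, measurable (K n)) -> 0 < e ->
  exists N, (P (\bigcup_n K n `\` \big[setU/set0]_(i < N) K i) < e%:E)%E.
Proof.
move=> mK e0; pose F n := \bigcup_k K k `\` \big[setU/set0]_(i < n) K i.
have mKU : measurable (\bigcup_n K n) by exact: bigcupT_measurable.
have mF n : measurable (F n) by apply: measurableD => //; exact: bigsetU_measurable.
have F0 : \bigcap_n F n = set0.
  rewrite -subset0 => x Fx; have [[n _ Knx] _] := Fx 0%N I.
  by have [_] := Fx n.+1 I; apply; rewrite -bigcup_mkord; exists n => /=.
have : P (F n) @[n --> \oo] --> 0%E.
  rewrite -(measure0 P) -F0; apply: nonincreasing_cvg_mu => //.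
  - by rewrite -ge0_fin_numE// fin_num_measure.
  - by rewrite F0.
  - apply/nonincreasing_seqP => n; apply/subsetPset; apply: setDS.
    by rewrite big_ord_recr/=; exact: subsetUl.
move=> /fine_cvgP[_ /cvgrPdist_lt/(_ _ e0)] [N _ /(_ N (leqnn N))].
rewrite sub0r normrN /= ger0_norm ?fine_ge0// => PN; exists N.
by rewrite -(@fineK _ (P (F N))) ?fin_num_measure// lte_fin.
Qed.

Section Regularity.
Context (R : realType) (T : pmetricType R).
Context (s : nat -> T) (ds : meets_balls s) (lcT : locally_compact [set: T]).

(** Local compactness puts a ball around each point of [U] into a compact subset of [U]; countably
    many such balls suffice. *)
Lemma open_bigcup_compact (U : set T) : open U -> exists K : nat -> set T,
  [/\ forall n, compact (K n), forall n, closed (K n) & U = \bigcup_n K n].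
Proof.
move=> oU.
pose Q (A : set T) := exists K, [/\ compact K, closed K, A `<=` K & K `<=` U].
have [B C BC [K [cK dK CK KU]]|x Ux|B [UB QB _]] :=
  @countable_ball_cover _ _ s Q U ds.
- by exists K; split => //; exact: subset_trans CK.
- have [N NN [cN dN]] := @lcT x I.
  have {}NN : nbhs x N by move: NN; rewrite withinET.
  have NU : nbhs x (N `&` U) by apply: filterI => //; exact: open_nbhs_nbhs.
  have [C /nbhs_ballP[e e0 eC] CNU] := uniform_regular NU.
  exists e => //; exists (closure C); split.
  + apply: subclosed_compact cN _; first exact: closed_closure.
    by move=> y /CNU[].
  + exact: closed_closure.
  + by apply: subset_trans eC _; exact: subset_closure.
  + by move=> y /CNU[].
have /choice[K HK] n : exists K, [/\ compact K, closed K, B n `<=` K & K `<=` U].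
  have [/QB//|/set0P/negP/negPn/eqP ->] := pselect (B n !=set0).
  by exists set0; split => //; [exact: compact0|exact: closed0].
exists K; split=> [n|n|]; [by have [] := HK n|by have [] := HK n|].
apply/seteqP; split=> [x /UB[n _ Bx]|x [n _ Kx]].
  by exists n => //; have [_ _ + _] := HK n; exact.
by have [_ _ _] := HK n; exact.
Qed.

Variable mu : probability (borel T) R.

Lemma open_inner_regular (U : set T) (e : R) : open U -> 0 < e ->
  exists K, [/\ compact K, closed K, K `<=` U & (mu (U `\` K) < e%:E)%E].
Proof.
move=> oU e0; have [K [cK dK UE]] := open_bigcup_compact oU.
have mK n : measurable (K n : set (borel T)) by exact: borel_closed.
have [N muN] := measure_bigcup_tail mu mK e0.
exists (\big[setU/set0]_(i < N) K i); split.
- exact: bigsetU_compact.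
- exact: closed_bigsetU.
- by rewrite UE -bigcup_mkord => x [n _ Kx]; exists n.
- by rewrite UE.
Qed.

(** The sets that admit such approximations form a sigma-algebra containing the open sets. *)
Lemma borel_regular (A : set (borel T)) (e : R) : measurable A -> 0 < e ->
  exists K U : set T, [/\ compact K, closed K, open U, K `<=` A /\ A `<=` U &
    (mu (U `\` K) < e%:E)%E].
Proof.
move=> mA; move: A mA e.
pose G : set (set (borel T)) := [set A | forall e : R, 0 < e -> exists K U : set T,
  [/\ compact K, closed K, open U, K `<=` A /\ A `<=` U &
    (mu (U `\` K) < e%:E)%E]].
suff : <<s @open T >> `<=` G by [].
have mD (U K : set T) : open U -> closed K -> measurable (U `\` K : set (borel T)).
  by move=> oU cK; apply: measurableD; [exact: borel_open|exact: borel_closed].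
apply: smallest_sub; last first.
  move=> U oU e e0; have [K [cK dK KU muK]] := open_inner_regular oU e0.
  by exists K, U; split => //; split.
split.
- move=> e e0; exists set0, set0; split => //.
  + exact: compact0.
  + exact: closed0.
  + exact: open0.
  + by split.
  + by rewrite setD0 measure0 lte_fin.
(* The complement of [U] need not be compact, so it is cut by a compact [L] carrying all but [e / 2]
   of the mass. *)
- move=> A GA e e0; have e20 : 0 < e / 2 by rewrite divr_gt0.
  have [K [U [cK dK oU [KA AU] muUK]]] := GA _ e20.
  have [L [cL dL _ muL]] := open_inner_regular openT e20.
  exists (L `\` U), (~` K); split.
  + by rewrite setDE; apply: compact_closedI => //; exact: open_closedC.
  + by rewrite setDE; apply: closedI => //; exact: open_closedC.
  + exact: closed_openC.
  + by rewrite setTD; split => [x [_ nUx] /AU|x nAx /KA].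
  + apply: (@le_lt_trans _ _ (mu (U `\` K) + mu (setT `\` L))%E).
      have m1 := mD _ _ oU dK.
      have m2 := mD _ _ openT dL.
      apply: (le_trans _ (measureU2 _ m1 m2)); apply: le_measure.
      * apply/mem_set/measurableD; first by apply: borel_open; exact: closed_openC.
        by apply: measurableD; [exact: borel_closed|exact: borel_open].
      * by apply/mem_set; exact: measurableU.
      * move=> x [nKx /not_andP[nL|/contrapT Ux]]; [by right|by left].
    by rewrite [e in e%:E]splitr EFinD lteD.
(* The gaps between [U n] and [K n] cost [e / 2] in total; truncating the union of the [K n] to a
   finite, hence compact, one costs the other half. *)
- move=> A GA e e0; have e20 : 0 < e / 2 by rewrite divr_gt0.
  have e2n n : 0 < e / 2 / (2 ^ n.+1)%:R by rewrite divr_gt0// ltr0n expn_gt0.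
  have /choice[K /choice[U HKU]] n := GA n _ (e2n n).
  have cK n : compact (K n) by have [] := HKU n.
  have dK n : closed (K n) by have [] := HKU n.
  have oU n : open (U n) by have [] := HKU n.
  have mK n : measurable (K n : set (borel T)) by exact: borel_closed.
  have [N muN] := measure_bigcup_tail mu mK e20.
  have dN : closed (\big[setU/set0]_(i < N) K i) by exact: closed_bigsetU.
  have oUU : open (\bigcup_n U n) by exact: bigcup_open.
  have mKU : measurable (\bigcup_n K n : set (borel T)) by exact: bigcupT_measurable.
  exists (\big[setU/set0]_(i < N) K i), (\bigcup_n U n); split => //.
  + exact: bigsetU_compact.
  + split=> [x|x [n _ Ax]].
      rewrite -bigcup_mkord => -[n _ Kx]; exists n => //.
      by have [_ _ _ [+ _] _] := HKU n; exact.
    by exists n => //; have [_ _ _ [_ +] _] := HKU n; exact.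
  + apply: (@le_lt_trans _ _ (mu (\bigcup_n U n `\` \bigcup_n K n) +
      mu (\bigcup_n K n `\` \big[setU/set0]_(i < N) K i))%E).
      have mb1 : measurable (\bigcup_n U n `\` \bigcup_n K n : set (borel T)).
        by apply: measurableD => //; exact: borel_open.
      have mb2 : measurable
          (\bigcup_n K n `\` \big[setU/set0]_(i < N) K i : set (borel T)).
        by apply: measurableD => //; exact: borel_closed.
      apply: (le_trans _ (measureU2 _ mb1 mb2)); apply: le_measure.
      * by apply/mem_set; exact: (mD _ _ oUU dN).
      * by apply/mem_set; exact: (measurableU _ _ mb1 mb2).
      * move=> x [Ux nKx]; have [Kx|nK] := pselect ((\bigcup_n K n) x).
          by right; exact: (conj Kx nKx).
        by left; exact: (conj Ux nK).
    rewrite [e in ltRHS]splitr EFinD; apply: lee_ltD => //.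
      by rewrite fin_num_measure//; apply: measurableD => //; exact: borel_open.
    apply: (@le_trans _ _ (\sum_(n <oo) (e / 2 / (2 ^ n.+1)%:R)%:E)%E).
      apply: (@le_trans _ _ (\sum_(n <oo) mu (U n `\` K n))%E).
        apply: measure_sigma_subadditive.
        * by move=> n; exact: mD.
        * by apply: measurableD => //; exact: borel_open.
        * move=> x [[n _ Ux] nK]; exists n => //; split => // Kx.
          by apply: nK; exists n.
      apply: (@lee_nneseries _ _ _ xpredT 0%N) => [n *|n *].
        exact: measure_ge0.
      by have [_ _ _ _ /ltW] := HKU n.
    exact: (epsilon_trick0 xpredT (ltW e20)).
Qed.

End Regularity.

(** * The optimal coupling *)

(** [x] is the telescoping sum of its slices between [k] and [k + 1], and each slice lies between
    the two indicators. *)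
Lemma layer_cake_bounds (R : realType) (x : R) (N : nat) : 0 <= x <= N%:R ->
  \sum_(k < N) (k.+1%:R < x)%R%:R <= x <= \sum_(k < N) (k%:R < x)%R%:R.
Proof.
move=> /andP[x0 xN].
have clip k :
    (k.+1%:R < x)%R%:R <= Num.min x k.+1%:R - Num.min x k%:R <= (k%:R < x)%R%:R.
  rewrite !minElt -natr1; set a : R := k%:R.
  have [h1|h1] := ltP x a; have [h2|h2] := ltP a x; have [h3|h3] := ltP x (a + 1);
    have [h4|h4] := ltP (a + 1) x; rewrite /=; try lra.
have xE : x = \sum_(k < N) (Num.min x k.+1%:R - Num.min x k%:R).
  rewrite -(big_mkord xpredT (fun k => Num.min x k.+1%:R - Num.min x k%:R)).
  by rewrite telescope_sumr// min_l// min_r// subr0.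
apply/andP; split; [rewrite [leRHS]xE|rewrite [leLHS]xE];
  by apply: ler_sum => k _; have /andP[] := clip k.
Qed.

Lemma continuous_borel_measurable (R : realType) (T : ptopologicalType)
    (f : T -> R) :
  continuous f -> measurable_fun [set: borel T] (f : borel T -> R).
Proof.
move=> cf; apply: (measurability _ (RGenOInfty.measurableE R)) => //.
move=> _ [_ [a ->] <-]; rewrite setTI; apply: borel_open.
by move/continuousP: cf; apply; exact: interval_open.
Qed.

Lemma Rexpectation_sum (R : realType) d (T : measurableType d) (P : probability T R)
    (f : nat -> T -> R) N : (forall n, bounded_measurable (f n)) ->
  bounded_measurable (fun x => \sum_(k < N) f k x) /\
  \int[P]_x (\sum_(k < N) f k x) = \sum_(k < N) \int[P]_x f k x.
Proof.
move=> bf; elim: N => [|N [bN iN]].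
  rewrite big_ord0 -[RHS](Rexpectation_cst P 0).
  have -> : (fun x => \sum_(k < 0) f k x) = cst 0.
    by apply/funext => x; rewrite big_ord0.
  by split => //; exact: bounded_measurable_cst.
have -> : (fun x => \sum_(k < N.+1) f k x) =
    (fun x => \sum_(k < N) f k x) \+ f N.
  by apply/funext => x; rewrite big_ord_recr.
rewrite big_ord_recr /= -iN -RexpectationD//.
by split => //; exact: bounded_measurableD.
Qed.

Lemma indic_fun_ge0 (R : realType) (T : Type) (A : set T) (x : T) : 0 <= \1_A x :> R.
Proof. by rewrite indicE ler0n. Qed.

Section ProductSets.
Context (X Y : topologicalType).

Lemma setX_preimage (A : set X) (B : set Y) : A `*` B = fst @^-1` A `&` snd @^-1` B.
Proof. by []. Qed.

Lemma open_setX (A : set X) (B : set Y) : open A -> open B -> open (A `*` B).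
Proof.
move=> oA oB; rewrite setX_preimage; apply: openI; apply: open_comp => // z _.
  exact: cvg_fst.
exact: cvg_snd.
Qed.

Lemma closed_setX (A : set X) (B : set Y) : closed A -> closed B -> closed (A `*` B).
Proof.
move=> oA oB; rewrite setX_preimage; apply: closedI; apply: closed_comp => // z _.
  exact: cvg_fst.
exact: cvg_snd.
Qed.

End ProductSets.

(* The library does not join its topological and pointed structures on pairs. *)
HB.instance Definition _ (X Y : ptopologicalType) := Pointed.on (X * Y)%type.

(** * From the functional to an optimal coupling *)

Section Primal.
Context (R : realType) (X Y : pmetricType R).
Context (s : nat -> X) (ds : meets_balls s) (lcX : locally_compact [set: X]).
Context (t : nat -> Y) (dt : meets_balls t) (lcY : locally_compact [set: Y]).
Context (mu : probability (borel X) R) (nu : probability (borel Y) R).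
Context (L : (X * Y -> R) -> R).
Hypothesis LD : forall f g, bounded_by_cst f -> bounded_by_cst g ->
  L (f \+ g) = L f + L g.
Hypothesis LZ : forall t f, bounded_by_cst f -> L (fun z => t * f z) = t * L f.
Hypothesis L_ge0 : forall f, bounded_by_cst f -> (forall z, 0 <= f z) -> 0 <= L f.
Hypothesis L_marginals : forall (phi : borel X -> R) (psi : borel Y -> R),
  bounded_measurable phi -> bounded_measurable psi ->
  L (fun z => phi z.1 + psi z.2) = \int[mu]_x phi x + \int[nu]_y psi y.

Lemma le_functional f g : bounded_by_cst f -> bounded_by_cst g ->
  (forall z, f z <= g z) -> L f <= L g.
Proof.
move=> bf bg fg; have bgf : bounded_by_cst (g - f).
  by apply: bounded_by_cstD => //; rewrite -scaleN1r; exact: bounded_by_cstZ.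
have -> : g = f \+ (g - f) by apply/funext => z /=; rewrite addrC subrK.
by rewrite LD// lerDl L_ge0// => z; rewrite subr_ge0.
Qed.

Lemma functional_cst r : L (cst r) = r.
Proof.
rewrite -[RHS]addr0 -[in RHS](Rexpectation_cst mu r).
rewrite -[X in _ + X](Rexpectation_cst nu 0).
rewrite -L_marginals; try exact: bounded_measurable_cst.
by congr L; apply/funext => z /=; rewrite addr0.
Qed.

Lemma functional_indicU (A B : set (X * Y)) : A `&` B = set0 ->
  L \1_(A `|` B) = L \1_A + L \1_B.
Proof.
move=> AB; rewrite -LD; [|exact: bounded_by_cst_indic..].
congr L; apply/funext => z; rewrite /= !indicE in_setU.
have [zA|zA] := boolP (z \in A);
  have [zB|zB] := boolP (z \in B); rewrite ?addr0 ?add0r//=.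
have : (A `&` B) z by split; exact: set_mem.
by rewrite AB.
Qed.

Definition functional_content : fin_additive R (X * Y) :=
  FinAdditive (fun A => L_ge0 (@bounded_by_cst_indic R _ A)
    (fun z => indic_fun_ge0 R A z)) functional_indicU.
Local Notation P := functional_content.

Lemma functional_content_fst (A : set (borel X)) : measurable A ->
  P (A `*` setT) = fine (mu A).
Proof.
move=> mA; rewrite -[RHS]addr0 -(Rexpectation_cst nu 0) -(Rexpectation_indic mu mA).
rewrite -L_marginals; last 2 first.
- exact: bounded_measurable_indic.
- exact: bounded_measurable_cst.
congr L; apply/funext => z; rewrite /= addr0 !indicE; congr (_ _)%:R.
by apply/idP/idP => /set_mem h; apply/mem_set; [case: h|split].
Qed.

Lemma functional_content_snd (B : set (borel Y)) : measurable B ->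
  P (setT `*` B) = fine (nu B).
Proof.
move=> mB; rewrite -[RHS]add0r -(Rexpectation_cst mu 0) -(Rexpectation_indic nu mB).
rewrite -L_marginals; last 2 first.
- exact: bounded_measurable_cst.
- exact: bounded_measurable_indic.
congr L; apply/funext => z; rewrite /= add0r !indicE; congr (_ _)%:R.
by apply/idP/idP => /set_mem h; apply/mem_set; [case: h|split].
Qed.

(** The gap between the outer and inner rectangles lies in two strips, whose contents are given by
    the marginals. *)
Lemma rectangle_regular (A : set (borel X)) (B : set (borel Y)) :
  measurable A -> measurable B -> compact_open_regular P (A `*` B).
Proof.
move=> mA mB e e0; have e20 : 0 < e / 2 by rewrite divr_gt0.
have [K1 [U1 [cK1 dK1 oU1 [KA AU] m1]]] := borel_regular ds lcX mu mA e20.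
have [K2 [U2 [cK2 dK2 oU2 [KB BU] m2]]] := borel_regular dt lcY nu mB e20.
have mD1 : measurable (U1 `\` K1 : set (borel X)).
  by apply: measurableD; [exact: borel_open|exact: borel_closed].
have mD2 : measurable (U2 `\` K2 : set (borel Y)).
  by apply: measurableD; [exact: borel_open|exact: borel_closed].
exists (K1 `*` K2), (U1 `*` U2); split.
- exact: compact_setX.
- exact: closed_setX.
- exact: open_setX.
- by split=> -[x y] [] => [/KA Ax /KB By|/AU Ax /BU By]; split.
apply: (@le_lt_trans _ _ (P ((U1 `\` K1) `*` setT) + P (setT `*` (U2 `\` K2)))).
  rewrite (le_trans _ (fin_additive_leU _ _ _))// le_fin_additive// => -[x y].
  by move=> [[Ux Uy] /not_andP[nx|ny]]; [left|right].
rewrite functional_content_fst// functional_content_snd// [e]splitr ltrD//.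
  by rewrite -lte_fin fineK// fin_num_measure.
by rewrite -lte_fin fineK// fin_num_measure.
Qed.

(** Balls of the product are rectangles of open balls, hence open and regular. *)
Lemma open_product_cover (G : set (X * Y)) : open G ->
  exists B : nat -> set (X * Y), G = \bigcup_n B n /\
    forall n, open (B n) /\ compact_open_regular P (B n).
Proof.
move=> oG; have [r dr] := meets_balls_pair ds dt.
have [B C BC CG|z Gz|B [GB BG Bball]] := @countable_ball_cover _ _ r
    (fun B => B `<=` G) G dr.
- exact: subset_trans CG.
- have /nbhs_ballP[e e0 eG] := open_nbhs_nbhs (conj oG Gz).
  by exists e.
exists B; split=> [|n].
  apply/seteqP; split => // z [n _ Bz].
  by apply: (BG n) => //; exists z.
have [->|[[x y] [e ->]]] := Bball n.
  by split; [exact: open0|exact: compact_open_regular0].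
have -> : ball (x, y) e = ball x e `*` ball y e :> set (X * Y) by [].
have ox : open (ball x e) by exact: open_metric_ball.
have oy : open (ball y e) by exact: open_metric_ball.
by split; [exact: open_setX|apply: rectangle_regular; exact: borel_open].
Qed.

Lemma coupling_of_functional : exists pi : probability (borel (X * Y)%type) R,
  couplings mu nu pi /\ forall G, open G -> (pi G <= (P G)%:E)%E.
Proof.
have [| | |pi piE] := @regular_sets_extension _ _ P.
- move=> G /open_product_cover[B [-> HB]]; apply: sigma_algebra_bigcup => n.
  by apply: sub_sigma_algebra; have [] := HB n.
- by rewrite -setXTT; apply: rectangle_regular; exact: measurableT.
- rewrite -setXTT functional_content_fst; last exact: measurableT.
  by have -> : mu setT = 1%E by exact: probability_setT.
exists pi; split.
  split=> [A mA|B mB]; rewrite /pushforward.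
    have -> : fst @^-1` A = A `*` setT :> set (X * Y).
      by apply/seteqP; split=> -[x y] //= [].
    rewrite piE; last by apply: rectangle_regular => //; exact: measurableT.
    by rewrite functional_content_fst// fineK// fin_num_measure.
  have -> : snd @^-1` B = setT `*` B :> set (X * Y).
    by apply/seteqP; split=> -[x y] //= [].
  rewrite piE; last by apply: rectangle_regular => //; exact: measurableT.
  by rewrite functional_content_snd// fineK// fin_num_measure.
(* [pi] and [P] agree on the finite unions [F n]. Only [pi] is known to be continuous along their
   increasing union, so monotonicity of [P] yields an inequality. *)
move=> G /open_product_cover[B [-> HB]].
pose F n := \big[setU/set0]_(i < n.+1) B i.
have oF n : open (F n).
  by rewrite /F -bigcup_mkord; apply: bigcup_open => i _; have [] := HB i.
have rF n : compact_open_regular P (F n).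
  rewrite /F; elim: n.+1 => [|m ih].
    by rewrite big_ord0; exact: compact_open_regular0.
  rewrite big_ord_recr; apply: compact_open_regularU => //.
  by have [] := HB m.
have FB : \bigcup_n F n = \bigcup_n B n by exact: bigcup_bigsetU_bigcup.
rewrite -FB; have : pi (F n) @[n --> \oo] --> pi (\bigcup_n F n).
  apply: nondecreasing_cvg_mu.
  - by move=> n; exact: borel_open.
  - by apply: borel_open; exact: bigcup_open.
  - move=> a b ab; apply/subsetPset.
    by apply: (@subset_bigsetU _ B); rewrite ltnS.
move=> piF; rewrite -(cvg_lim _ piF)//; apply: lime_le.
  by apply/cvg_ex; exists (pi (\bigcup_n F n)).
apply: nearW => n; rewrite piE// lee_fin le_fin_additive//.
by move=> z Fz; exists n.
Qed.

(** Slicing [n * (c + M)] at integer levels gives the inequality up to an error of 1, whatever [n]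
    is; dividing by a large [n] removes it. *)
Lemma expectation_le_functional (pi : probability (borel (X * Y)%type) R)
    (c : X * Y -> R) : (forall G, open G -> (pi G <= (P G)%:E)%E) ->
  continuous c -> bounded_by_cst c -> \int[pi]_z c z <= L c.
Proof.
move=> piP cc [M cM].
have cM0 z : 0 <= c z + M by have := cM z; rewrite ler_norml; lra.
have bc : bounded_by_cst c by exists M.
have bcst r : bounded_by_cst (cst r : X * Y -> R) by exists `|r|.
have bcD : bounded_by_cst (fun z => c z + M) by exact: (bounded_by_cstD bc (bcst M)).
have bmc : bounded_measurable (c : borel (X * Y)%type -> R).
  by split => //; exact: continuous_borel_measurable.
have bmD : bounded_measurable (fun z : borel (X * Y)%type => c z + M).
  exact: (bounded_measurableD bmc (bounded_measurable_cst _ M)).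
suff H n : n%:R * \int[pi]_z (c z + M) <= n%:R * L (fun z => c z + M) + 1.
  have {}H : \int[pi]_z (c z + M) <= L (fun z => c z + M).
    rewrite leNgt; apply/negP => lt.
    set d := \int[pi]_z (c z + M) - L (fun z => c z + M).
    have d0 : 0 < d by rewrite subr_gt0.
    have := archi_boundP (ltW (divr_gt0 ltr01 d0)).
    by rewrite ltr_pdivrMr// mulrBr; have := H (Num.bound (1 / d)); lra.
  move: H; rewrite (RexpectationD _ bmc (bounded_measurable_cst _ M)).
  by rewrite Rexpectation_cst (LD bc (bcst M)) functional_cst lerD2r.
pose g z := n%:R * (c z + M).
have bg : bounded_by_cst g by exact: bounded_by_cstZ.
have bmg : bounded_measurable (g : borel (X * Y)%type -> R).
  exact: bounded_measurableZ.
have cg : continuous g.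
  by move=> z; apply: cvgM; [exact: cvg_cst|apply: cvgD; [exact: cc|exact: cvg_cst]].
have [N gN] : exists N : nat, forall z, 0 <= g z <= N%:R.
  have [K gK] := bg; exists (Num.bound `|K|) => z.
  rewrite mulr_ge0//= (le_trans (ler_norm _))// (le_trans (gK z))//.
  by rewrite (le_trans (ler_norm _))// ltW// archi_boundP.
pose U k : set (X * Y) := [set z | k%:R < g z].
have oU k : open (U k).
  rewrite (_ : U k = g @^-1` `]k%:R, +oo[).
    by move/continuousP: cg; apply; exact: interval_open.
  by apply/seteqP; split => z; rewrite /U /= in_itv/= andbT.
have UE k z : \1_(U k) z = (k%:R < g z)%R%:R :> R.
  by rewrite indicE; congr (_ _)%:R; apply/idP/idP => [/set_mem|/mem_set].
have mU k : measurable (U k : set (borel (X * Y)%type)) by exact: borel_open.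
have bU k := bounded_by_cst_indic R (U k).
rewrite -LZ// -RexpectationZ//.
have lower : \sum_(k < N) P (U k.+1) <= L g.
  have [bs ->] : bounded_by_cst (fun z => \sum_(k < N) \1_(U k.+1) z : R) /\
      \sum_(k < N) P (U k.+1) = L (fun z => \sum_(k < N) \1_(U k.+1) z).
    elim: (N) => [|m [bm im]].
      rewrite big_ord0 -[LHS](functional_cst 0).
      have -> : (fun z => \sum_(k < 0) \1_(U k.+1) z) = cst 0 :> (X * Y -> R).
        by apply/funext => z; rewrite big_ord0.
      by split.
    have -> : (fun z => \sum_(k < m.+1) \1_(U k.+1) z) =
        (fun z => \sum_(k < m) \1_(U k.+1) z) \+ \1_(U m.+1) :> (X * Y -> R).
      by apply/funext => z; rewrite big_ord_recr.
    by rewrite big_ord_recr /= im -LD//; split => //; exact: bounded_by_cstD.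
  apply: le_functional => // z; under eq_bigr do rewrite UE.
  by have /andP[] := layer_cake_bounds (gN z).
have upper : \int[pi]_z g z <= \sum_(k < N) P (U k).
  have bmU k : bounded_measurable (\1_(U k) : borel (X * Y)%type -> R).
    exact: bounded_measurable_indic.
  have [bs sE] := Rexpectation_sum pi N bmU.
  apply: (@le_trans _ _ (\int[pi]_z (\sum_(k < N) \1_(U k) z))).
    apply: le_Rexpectation => // z; under eq_bigr do rewrite UE.
    by have /andP[] := layer_cake_bounds (gN z).
  rewrite sE; apply: ler_sum => k _; rewrite Rexpectation_indic//.
  by rewrite -lee_fin fineK ?fin_num_measure// piP.
have PT : P (U 0%N) <= 1.
  rewrite -[leRHS]functional_cst; apply: le_functional => // z.
  by rewrite UE lern1; case: (_ < _).
(* The upper and lower sums differ by an index shift, which costs at most [P (U 0)]. *)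
have : \sum_(k < N) P (U k) + P (U N) = P (U 0%N) + \sum_(k < N) P (U k.+1).
  rewrite -(big_mkord xpredT (fun k => P (U k))).
  by rewrite -(big_mkord xpredT (fun k => P (U k.+1))) -big_nat_recr// big_nat_recl.
have := fin_additive_ge0 P (U N).
by lra.
Qed.
End Primal.

(** * Dual maximizers among measurable pairs *)

Lemma Rexpectation_pushforward (R : realType) d1 d2 (T1 : measurableType d1)
    (T2 : measurableType d2) (P : probability T1 R) (Q : probability T2 R)
    (h : T1 -> T2) (f : T2 -> R) : measurable_fun setT h -> bounded_measurable f ->
  (forall A, measurable A -> pushforward P h A = Q A) ->
  bounded_measurable (f \o h) /\ \int[P]_x f (h x) = \int[Q]_y f y.
Proof.
move=> mh [mf [M fM]] PQ.
have bfh : bounded_measurable (f \o h).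
  by split; [exact: measurableT_comp|exists M => x; exact: fM].
split=> //; rewrite /Rintegral; congr fine.
rewrite -[RHS](@eq_measure_integral _ _ _ _ _ (pushforward P h)); last first.
  by move=> A mA _; exact: PQ.
rewrite integral_pushforward//; first exact/measurable_EFinP.
exact: bounded_measurable_integrable.
Qed.

Lemma Rexpectation_cvg (R : realType) d (T : measurableType d) (P : probability T R)
    (u : nat -> T -> R) (f : T -> R) (M : R) :
  (forall n, measurable_fun setT (u n)) -> (forall n x, `|u n x| <= M) ->
  (forall x, u n x @[n --> \oo] --> f x) ->
  [/\ measurable_fun setT f, forall x, `|f x| <= M &
      \int[P]_x u n x @[n --> \oo] --> \int[P]_x f x].
Proof.
move=> mu uM uf.
have mf : measurable_fun setT f by apply: (measurable_fun_cvg mu) => x _; exact: uf.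
have fM x : `|f x| <= M.
  have uf' : `|u n x| @[n --> \oo] --> `|f x| by exact: cvg_norm (uf x).
  rewrite -(cvg_lim _ uf')//; apply: limr_le.
    by apply/cvg_ex; exists `|f x|.
  by apply: nearW => n; exact: uM.
split => //.
have bu n : bounded_measurable (u n) by split => //; exists M.
have bf : bounded_measurable f by split => //; exists M.
have [] := @dominated_convergence _ _ _ P setT measurableT
  (fun n x => (u n x)%:E) (fun x => (f x)%:E) (cst M%:E).
- by move=> n; exact/measurable_EFinP.
- exact/measurable_EFinP.
- by apply: aeW => x _; apply/cvg_EFin; [exact: nearW|exact: uf].
- exact: (bounded_measurable_integrable P (bounded_measurable_cst _ M)).
- by apply: aeW => x n _; rewrite lee_fin.
by move=> _ _; rewrite EFin_Rexpectation// => /fine_cvgP[_].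
Qed.

(** The window of indices runs from [n] to [n + m], both included. *)
Fixpoint running_max (R : realType) (T : Type) (u : nat -> T -> R) n m : T -> R :=
  if m is m'.+1 then running_max u n m' \max u (n + m)%N else u n.

Section RunningMax.
Context (R : realType) (T : Type) (u : nat -> T -> R).

Lemma running_max_ind (Q : (T -> R) -> Prop) n m : (forall n, Q (u n)) ->
  (forall f g, Q f -> Q g -> Q (f \max g)) -> Q (running_max u n m).
Proof. by move=> Qu Qmax; elim: m => //= m ih; exact: Qmax. Qed.

Lemma running_max_bound M n m x : (forall n x, `|u n x| <= M) ->
  `|running_max u n m x| <= M.
Proof.
move=> uM; apply: (running_max_ind (Q := fun f => `|f x| <= M)) => // f g fM gM.
by rewrite /=; case: (leP (f x) (g x)).
Qed.

Lemma running_max_nondecreasing n x :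
  nondecreasing_seq (fun m => running_max u n m x).
Proof. by apply/nondecreasing_seqP => m /=; rewrite le_max lexx. Qed.

Lemma running_maxS n m x : running_max u n.+1 m x <= running_max u n m.+1 x.
Proof.
elim: m => [|m ih]; first by rewrite /= addn1 le_max lexx orbT.
have -> : running_max u n.+1 m.+1 x =
  Num.max (running_max u n.+1 m x) (u (n.+1 + m.+1)%N x) by [].
have -> : running_max u n m.+2 x =
  Num.max (running_max u n m.+1 x) (u (n + m.+2)%N x) by [].
rewrite ge_max addSnnS.
by apply/andP; split; rewrite le_max; apply/orP; [left|right].
Qed.

Variables (M : R) (uM : forall n x, `|u n x| <= M).

(** The supremum over indices from [n] on, taken as a limit so that dominated convergence
    applies. *)
Definition tail_sup n x : R := limn (fun m => running_max u n m x).

Lemma running_max_cvg n x : cvgn (fun m => running_max u n m x).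
Proof.
apply: nondecreasing_is_cvgn; first exact: running_max_nondecreasing.
exists M => _ [m _ <-]; rewrite (le_trans (ler_norm _))//.
exact: running_max_bound.
Qed.

Lemma tail_sup_bound n x : `|tail_sup n x| <= M.
Proof.
have h : `|running_max u n m x| @[m --> \oo] --> `|tail_sup n x|.
  by apply: cvg_norm; exact: running_max_cvg.
rewrite -(cvg_lim _ h)//; apply: limr_le.
  by apply/cvg_ex; exists `|tail_sup n x|.
by apply: nearW => m; exact: running_max_bound.
Qed.

Lemma tail_sup_cvg x : cvgn (tail_sup ^~ x).
Proof.
apply: nonincreasing_is_cvgn.
  apply/nonincreasing_seqP => n; apply: limr_le; first exact: running_max_cvg.
  apply: nearW => m; apply: le_trans (running_maxS _ _ _) _.
  apply: (@nondecreasing_cvgn_le _ (fun m => running_max u n m x)).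
    exact: running_max_nondecreasing.
  exact: running_max_cvg.
exists (- M) => _ [n _ <-].
by have := tail_sup_bound n x; rewrite ler_norml => /andP[].
Qed.

End RunningMax.

Section DualMaximizer.
Context (R : realType) d1 d2 (T1 : measurableType d1) (T2 : measurableType d2).
Context (P1 : probability T1 R) (P2 : probability T2 R) (c : T1 * T2 -> R) (M : R).

Definition dual_gain (f : (T1 -> R) * (T2 -> R)) : R :=
  \int[P1]_x f.1 x - \int[P2]_y f.2 y.

(** The uniform bound [M] makes the set stable under pointwise limits and the gains convergent along
    them. *)
Definition dual_feasible : set ((T1 -> R) * (T2 -> R)) :=
  [set f : (T1 -> R) * (T2 -> R) |
    [/\ measurable_fun setT f.1 /\ measurable_fun setT f.2,
     forall x, `|f.1 x| <= M, forall y, `|f.2 y| <= M &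
     forall x y, f.1 x - f.2 y <= c (x, y)]].

Lemma dual_feasible_bounded f : dual_feasible f ->
  bounded_measurable f.1 /\ bounded_measurable f.2.
Proof. by move=> [[m1 m2] b1 b2 _]; split; split => //; exists M. Qed.

(** Whichever pair attains the first maximum satisfies the constraint with its own second component,
    and enlarging that component preserves it. *)
Lemma dual_feasible_max f g : dual_feasible f -> dual_feasible g ->
  dual_feasible (f.1 \max g.1, f.2 \max g.2).
Proof.
move=> [[mf1 mf2] bf1 bf2 fc] [[mg1 mg2] bg1 bg2 gc]; split => /=.
- by split; exact: measurable_maxr.
- by move=> x; case: (leP (f.1 x) (g.1 x)).
- by move=> y; case: (leP (f.2 y) (g.2 y)).
- move=> x y; have := fc x y; have := gc x y.
  by case: (leP (f.1 x) (g.1 x)); case: (leP (f.2 y) (g.2 y)); lra.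
Qed.

Lemma dual_feasible_min f g : dual_feasible f -> dual_feasible g ->
  dual_feasible (f.1 \min g.1, f.2 \min g.2).
Proof.
move=> [[mf1 mf2] bf1 bf2 fc] [[mg1 mg2] bg1 bg2 gc]; split => /=.
- by split; exact: measurable_minr.
- by move=> x; case: (leP (f.1 x) (g.1 x)).
- by move=> y; case: (leP (f.2 y) (g.2 y)).
- move=> x y; have := fc x y; have := gc x y.
  by case: (leP (f.1 x) (g.1 x)); case: (leP (f.2 y) (g.2 y)); lra.
Qed.

Lemma dual_gain_modular f g : dual_feasible f -> dual_feasible g ->
  dual_gain (f.1 \max g.1, f.2 \max g.2) + dual_gain (f.1 \min g.1, f.2 \min g.2) =
  dual_gain f + dual_gain g.
Proof.
move=> Sf Sg; have [bf1 bf2] := dual_feasible_bounded Sf.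
have [bg1 bg2] := dual_feasible_bounded Sg.
have [bM1 bM2] := dual_feasible_bounded (dual_feasible_max Sf Sg).
have [bm1 bm2] := dual_feasible_bounded (dual_feasible_min Sf Sg).
have modular d (T : measurableType d) (P : probability T R) (u v : T -> R) :
    bounded_measurable u -> bounded_measurable v ->
    bounded_measurable (u \max v) -> bounded_measurable (u \min v) ->
    \int[P]_x (u \max v) x + \int[P]_x (u \min v) x = \int[P]_x u x + \int[P]_x v x.
  move=> bu bv bM bm; rewrite -!RexpectationD//; apply: eq_Rintegral => x _.
  exact: addr_max_min.
have := modular _ _ P1 _ _ bf1 bg1 bM1 bm1.
have := modular _ _ P2 _ _ bf2 bg2 bM2 bm2.
by rewrite /dual_gain /=; lra.
Qed.

Lemma dual_feasible_cvg (f : nat -> (T1 -> R) * (T2 -> R)) g :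
  (forall n, dual_feasible (f n)) ->
  (forall x, (f n).1 x @[n --> \oo] --> g.1 x) ->
  (forall y, (f n).2 y @[n --> \oo] --> g.2 y) ->
  dual_feasible g /\ dual_gain (f n) @[n --> \oo] --> dual_gain g.
Proof.
move=> Sf f1 f2.
have m1 n : measurable_fun setT (f n).1 by have [[]] := Sf n.
have m2 n : measurable_fun setT (f n).2 by have [[]] := Sf n.
have b1 n x : `|(f n).1 x| <= M by have [_ + _ _] := Sf n; exact.
have b2 n y : `|(f n).2 y| <= M by have [_ _ + _] := Sf n; exact.
have [mg1 bg1 i1] := Rexpectation_cvg P1 m1 b1 f1.
have [mg2 bg2 i2] := Rexpectation_cvg P2 m2 b2 f2.
split; last exact: cvgB.
split => // x y.
have h : (f n).1 x - (f n).2 y @[n --> \oo] --> g.1 x - g.2 y by exact: cvgB.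
rewrite -(cvg_lim _ h)//; apply: limr_le.
  by apply/cvg_ex; exists (g.1 x - g.2 y).
by apply: nearW => n; have [_ _ _] := Sf n; exact.
Qed.

(* Since [max] and [min] preserve feasibility and the gain is modular, the gain
   deficits of a maximizing sequence add up under [max]; if they are summable,
   the limsup of the sequence is optimal and no compactness is needed. *)
Lemma dual_maximizer : dual_feasible !=set0 ->
  exists2 f, dual_feasible f &
    forall g, dual_feasible g -> dual_gain g <= dual_gain f.
Proof.
move=> [f0 Sf0].
pose V := dual_gain @` dual_feasible.
have V_ub : has_sup V.
  split; first by exists (dual_gain f0), f0.
  exists (M + M) => _ [f Sf <-]; have [b1 b2] := dual_feasible_bounded Sf.
  have [_ f1M f2M _] := Sf; rewrite /dual_gain lerD//.
    rewrite -(Rexpectation_cst P1 M); apply: le_Rexpectation => //.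
      exact: bounded_measurable_cst.
    by move=> x; exact: le_trans (ler_norm _) (f1M x).
  rewrite -RexpectationN// -(Rexpectation_cst P2 M); apply: le_Rexpectation => //.
  - exact: bounded_measurableN.
  - exact: bounded_measurable_cst.
  - by move=> y; rewrite (le_trans (ler_norm _))// normrN.
have VD f : dual_feasible f -> dual_gain f <= sup V.
  by move=> Sf; apply: ub_le_sup; [have [] := V_ub|exists f].
(* Over the window from [n] to [n + m] these deficits sum to [h n * 2 - h (n + m)], the bound in
   [Jr]. *)
pose h n : R := (2^-1) ^+ n.
have h_gt0 n : 0 < h n by rewrite exprn_gt0// invr_gt0.
have hS n : h n.+1 = h n / 2 by rewrite /h exprSr.
have /choice[f Hf] n : exists f, dual_feasible f /\ sup V - h n < dual_gain f.
  by have [_ [f Sf <-] ?] := sup_adherent (h_gt0 n) V_ub; exists f.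
have Sf n : dual_feasible (f n) by have [] := Hf n.
pose u1 n := (f n).1; pose u2 n := (f n).2.
pose r n m := (running_max u1 n m, running_max u2 n m).
have u1M n x : `|u1 n x| <= M by have [_ + _ _] := Sf n; exact.
have u2M n y : `|u2 n y| <= M by have [_ _ + _] := Sf n; exact.
have Sr n m : dual_feasible (r n m).
  elim: m => [|m ih]; last exact: dual_feasible_max ih (Sf (n + m.+1)%N).
  by rewrite /r /u1 /u2 /= -surjective_pairing.
have Jr n m : sup V - (h n * 2 - h (n + m)%N) <= dual_gain (r n m).
  elim: m => [|m ih].
    have [_] := Hf n; rewrite addn0 /r /u1 /u2 /= -surjective_pairing.
    by lra.
  (* The minimum is feasible, so its gain is at most [sup V]; modularity turns this into a lower
     bound for the gain of the maximum. *)
  have := dual_gain_modular (Sr n m) (Sf (n + m.+1)%N).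
  have := VD _ (dual_feasible_min (Sr n m) (Sf (n + m.+1)%N)).
  have [_] := Hf (n + m.+1)%N.
  rewrite -/(r n m.+1) addnS hS; lra.
pose t n := (tail_sup u1 n, tail_sup u2 n).
have tP n : dual_feasible (t n) /\
    dual_gain (r n m) @[m --> \oo] --> dual_gain (t n).
  apply: dual_feasible_cvg => //= x; exact: running_max_cvg.
have Jt n : sup V - h n * 2 <= dual_gain (t n).
  have [_ rt] := tP n; rewrite -(cvg_lim _ rt)//; apply: limr_ge.
    by apply/cvg_ex; exists (dual_gain (t n)).
  by apply: nearW => m; have := Jr n m; have := h_gt0 (n + m)%N; lra.
pose g := (fun x => limn (tail_sup u1 ^~ x), fun y => limn (tail_sup u2 ^~ y)).
have [Sg tg] : dual_feasible g /\ dual_gain (t n) @[n --> \oo] --> dual_gain g.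
  by apply: dual_feasible_cvg => [n|x|y]; [have [] := tP n|exact: tail_sup_cvg..].
exists g => // f' Sf'; apply: le_trans (VD _ Sf') _.
have h0 : sup V - h n * 2 @[n --> \oo] --> sup V - 0 * 2.
  apply: cvgB; first exact: cvg_cst.
  apply: cvgMl; apply: cvg_expr; rewrite ger0_norm ?invr_ge0//.
  by rewrite invf_lt1// ltr1n.
rewrite mul0r subr0 in h0; apply: ler_cvg_to h0 tg _.
exact: nearW.
Qed.

End DualMaximizer.

(** * Double c-transforms *)

(** Exchanging [x] and [y] makes the bound two-sided; [|K| + 1] replaces [K], whose sign is
    arbitrary. *)
Lemma mdist_lipschitz_continuous (R : realType) (T : metricType R) (f : T -> R)
    (K : R) :
  (forall x y, f x <= f y + K * mdist x y) -> continuous f.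
Proof.
move=> fK x; apply/cvgrPdist_lt => e e0.
have K0 : 0 < `|K| + 1 by rewrite ltr_wpDl.
have xK : K < `|K| + 1 by rewrite (le_lt_trans (ler_norm _))// ltrDl.
apply/nbhs_ballP; exists (e / (`|K| + 1)) => /=; first exact: divr_gt0.
move=> y; rewrite ballEmdist /= ltr_pdivlMr// mulrC => xy.
have Kd : K * mdist x y < e.
  by apply: le_lt_trans xy; rewrite ler_wpM2r ?mdist_ge0// ltW.
have := fK x y; have := fK y x; rewrite (metric_sym y x) ltr_norml.
by lra.
Qed.

(** The c-transform for a cost [k]. The opposite transform, an infimum, arises by swapping the
    arguments of the cost and changing signs. *)
Definition sup_transform (R : realType) (A B : Type) (k : A -> B -> R) (u : A -> R)
  (b : B) : R := sup (range (fun a => u a - k a b)).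

Section SupTransform.
Context (R : realType) (A : pointedType) (B : Type) (k : A -> B -> R) (u : A -> R).
Hypotheses (bk : exists M, forall a b, `|k a b| <= M)
  (bu : exists M, forall a, u a <= M).

Lemma sup_transform_has_sup b : has_sup (range (fun a => u a - k a b)).
Proof.
split; first by exists (u point - k point b), point.
have [[M kM] [N uN]] := (bk, bu); exists (N + M) => _ [a _ <-].
by have := kM a b; have := uN a; rewrite ler_norml; lra.
Qed.

Lemma sup_transform_ge a b : u a - k a b <= sup_transform k u b.
Proof. by apply: ub_le_sup; [have [] := sup_transform_has_sup b|exists a]. Qed.

Lemma sup_transform_le r b :
  (forall a, u a - k a b <= r) -> sup_transform k u b <= r.
Proof.
move=> ur; apply: ge_sup => [|_ [a _ <-]//].
by have [] := sup_transform_has_sup b.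
Qed.

End SupTransform.

Lemma sup_transform_lipschitz (R : realType) (A : pointedType) (T : metricType R)
    (k : A -> T -> R) (u : A -> R) (K : R) :
  (exists M, forall a b, `|k a b| <= M) -> (exists M, forall a, u a <= M) ->
  (forall a x y, k a y <= k a x + K * mdist x y) ->
  forall x y, sup_transform k u x <= sup_transform k u y + K * mdist x y.
Proof.
move=> bk bu kK x y; apply: sup_transform_le => // a.
by have := sup_transform_ge bk bu a y; have := kK a x y; lra.
Qed.

Section LipschitzImprovement.
Context (R : realType) (X Y : pmetricType R) (c : X * Y -> R) (M : R).
Hypotheses (c_lip : lipschitz_prod c) (cM : forall z, `|c z| <= M).
Context (mu : probability (borel X) R) (nu : probability (borel Y) R).

Lemma admissible_pairs_dual_feasible (f : (X -> R) * (Y -> R)) (B : R) :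
  admissible_pairs c f -> (forall x, `|f.1 x| <= B) -> (forall y, `|f.2 y| <= B) ->
  @dual_feasible R _ _ (borel X) (borel Y) c B f.
Proof.
move=> [[c1 _] [c2 _] fc] b1 b2; split => //.
by split; exact: continuous_borel_measurable.
Qed.

(* The double c-transform of [f], shifted so that its first component before
   the transform has supremum [0]; this makes the bound independent of [f]. *)
Lemma lipschitz_improvement (f : (borel X -> R) * (borel Y -> R)) :
  bounded_measurable f.1 -> bounded_measurable f.2 ->
  (forall x y, f.1 x - f.2 y <= c (x, y)) ->
  exists g : (X -> R) * (Y -> R),
    [/\ admissible_pairs c g, @dual_feasible R _ _ (borel X) (borel Y) c (2 * M) g &
        dual_gain mu nu f <= dual_gain mu nu g].
Proof.
case: f => phi psi /= bphi bpsi fc.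
have [K cK] := c_lip.
have [_ [N phiN]] := bphi.
have phi_sup : has_sup (range phi).
  split; first by exists (phi point), point.
  by exists N => _ [x _ <-]; rewrite (le_trans (ler_norm _)).
pose s := sup (range phi).
have phis x : phi x <= s by apply: ub_le_sup; [have [] := phi_sup|exists x].
pose c1 x y := c (x, y); pose c2 y x := c (x, y).
have bc1 : exists M, forall x y, `|c1 x y| <= M by exists M => x y; exact: cM.
have bc2 : exists M, forall y x, `|c2 y x| <= M by exists M => x y; exact: cM.
have c1K x y y' : c1 x y' <= c1 x y + K * mdist y y'.
  have := cK (x, y') (x, y); rewrite /prod_mdist /= mdistxx max_r ?mdist_ge0//.
  by rewrite (metric_sym y' y) ler_norml /c1; lra.
have c2K y x x' : c2 y x' <= c2 y x + K * mdist x x'.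
  have := cK (x', y) (x, y); rewrite /prod_mdist /= mdistxx max_l ?mdist_ge0//.
  by rewrite (metric_sym x' x) ler_norml /c2; lra.
pose u (x : X) := phi x - s.
have bu : exists M, forall x, u x <= M by exists 0 => x; rewrite subr_le0.
pose v := sup_transform c1 u.
have v_ge x y : u x - c (x, y) <= v y by exact: (sup_transform_ge bc1 bu).
have v_le y r : (forall x, u x - c (x, y) <= r) -> v y <= r.
  exact: sup_transform_le.
have cM' z : - M <= c z <= M by rewrite -ler_norml.
have vM y : `|v y| <= M.
  rewrite ler_norml; apply/andP; split.
    (* The lower bound on [v] uses that [s] is the least upper bound of [phi]. *)
    have : s <= v y + M + s.
      apply: ge_sup => [|_ [x _ <-]]; first by have [] := phi_sup.
      by have := v_ge x y; have := cM' (x, y); rewrite /u; lra.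
    by lra.
  apply: v_le => x.
  by have := phis x; have := cM' (x, y); rewrite /u; lra.
have vM' y : - M <= v y <= M by rewrite -ler_norml.
have bv : exists M, forall y, - v y <= M by exists M => y; have := vM' y; lra.
(* This is the infimum over [y] of [v y + c (x, y)], the largest function admissible with [v]. *)
pose w x := - sup_transform c2 (fun y => - v y) x.
have w_le x y : w x <= v y + c (x, y).
  by have := sup_transform_ge bc2 bv y x; rewrite /w /c2; lra.
have w_ge x r : (forall y, r <= v y + c (x, y)) -> r <= w x.
  move=> h; rewrite /w lerNr; apply: sup_transform_le => // y.
  by have := h y; rewrite /c2; lra.
have wM x : `|w x| <= 2 * M.
  rewrite ler_norml; apply/andP; split; last first.
    by have := w_le x point; have := vM' point; have := cM' (x, point); lra.
  by apply: w_ge => y; have := vM' y; have := cM' (x, y); lra.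
have v_cont : continuous v.
  by apply: (@mdist_lipschitz_continuous _ _ _ K); exact: sup_transform_lipschitz.
have w_cont : continuous w.
  apply: (@mdist_lipschitz_continuous _ _ _ K) => x x'.
  have := sup_transform_lipschitz bc2 bv c2K x' x.
  by rewrite (metric_sym x' x) /w; lra.
have M_ge0 : 0 <= M by apply: le_trans (cM point); exact: normr_ge0.
have v2M y : `|v y| <= 2 * M by have := vM y; lra.
have bounded (T : Type) (h : T -> R) : (forall x, `|h x| <= 2 * M) ->
    bounded_fun (h : T -> R^o).
  move=> hM; exists (2 * M); split; first exact: num_real.
  by move=> r Mr x _; exact: le_trans (hM x) (ltW Mr).
have adm : admissible_pairs c (w, v).
  split; [split => //; exact: bounded|split => //; exact: bounded|].
  by move=> x y /=; have := w_le x y; lra.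
exists (w, v); have Sg := admissible_pairs_dual_feasible adm wM v2M.
split => //; have [bw bv'] := dual_feasible_bounded Sg.
have bu' : bounded_measurable (u : borel X -> R).
  exact: (bounded_measurableD bphi (bounded_measurable_cst _ (- s))).
(* Subtracting [s] from both components leaves the gain unchanged, as both measures have mass 1. *)
have bpsis : bounded_measurable (fun y : borel Y => psi y - s).
  exact: (bounded_measurableD bpsi (bounded_measurable_cst _ (- s))).
have l1 : \int[mu]_x u x <= \int[mu]_x w x.
  apply: le_Rexpectation => // x; apply: w_ge => y.
  by have := v_ge x y; lra.
have l2 : \int[nu]_y v y <= \int[nu]_y (psi y - s).
  apply: le_Rexpectation => // y; apply: v_le => x.
  by have := fc x y; rewrite /u; lra.
have e1 : \int[mu]_x u x = \int[mu]_x phi x - s.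
  rewrite (RexpectationD _ bphi (bounded_measurable_cst _ (- s))).
  by rewrite Rexpectation_cst.
have e2 : \int[nu]_y (psi y - s) = \int[nu]_y psi y - s.
  rewrite (RexpectationD _ bpsi (bounded_measurable_cst _ (- s))).
  by rewrite Rexpectation_cst.
by rewrite /dual_gain /=; lra.
Qed.

End LipschitzImprovement.

(** * Duality *)

Lemma bounded_fun_cst (R : realType) (T : Type) (f : T -> R) :
  bounded_fun (f : T -> R^o) -> bounded_by_cst f.
Proof.
(* [bounded_fun] supplies bounds only strictly above [M]. *)
move=> [M [_ fM]]; exists (M + 1) => x; apply: (fM (M + 1)) => //.
by rewrite ltrDl.
Qed.

Lemma lipschitz_prod_continuous (R : realType) (X Y : metricType R)
    (c : X * Y -> R) :
  lipschitz_prod c -> continuous c.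
Proof.
move=> [K cK] [x y]; apply/cvgrPdist_lt => e e0.
have K0 : 0 < `|K| + 1 by rewrite ltr_wpDl.
have xK : K < `|K| + 1 by rewrite (le_lt_trans (ler_norm _))// ltrDl.
apply/(@nbhs_ballP _ (X * Y)%type); exists (e / (`|K| + 1)) => /=.
  exact: divr_gt0.
move=> [x' y'] [] /=; rewrite !ballEmdist /= => xx' yy'.
apply: (le_lt_trans (cK _ _)); rewrite /prod_mdist /=.
set d := Num.max _ _.
have d0 : 0 <= d by rewrite le_max mdist_ge0.
have : d < e / (`|K| + 1) by rewrite gt_max xx' yy'.
rewrite ltr_pdivlMr// mulrC; apply: le_lt_trans.
by rewrite ler_wpM2r// ltW.
Qed.

Lemma continuous_borel_fun (T U : ptopologicalType) (f : T -> U) :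
  continuous f -> measurable_fun [set: borel T] (f : borel T -> borel U).
Proof.
move=> cf; apply: (@measurability _ _ (borel T) (borel U) setT f (@open U) erefl).
move=> _ [A oA <-]; rewrite setTI; apply: borel_open.
by move/continuousP: cf; apply.
Qed.

Lemma bounded_continuous_measurable (R : realType) (T : ptopologicalType)
    (f : T -> R) :
  bounded_continuous f -> bounded_measurable (f : borel T -> R).
Proof.
move=> [cf bf]; split; first exact: continuous_borel_measurable.
exact: bounded_fun_cst.
Qed.

Section WeakDuality.
Context (R : realType) (X Y : pmetricType R) (c : X * Y -> R).
Context (mu : probability (borel X) R) (nu : probability (borel Y) R).

Lemma dual_valueE f : admissible_pairs c f ->
  dual_value mu nu f = (dual_gain mu nu f)%:E.
Proof.
move=> [/bounded_continuous_measurable b1 /bounded_continuous_measurable b2 _].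
by rewrite /dual_value !EFin_Rexpectation// -EFinB.
Qed.

Hypothesis bc : bounded_measurable (c : borel (X * Y)%type -> R).

Lemma transport_costE (pi : probability (borel (X * Y)%type) R) :
  transport_cost c pi = (\int[pi]_z c z)%:E.
Proof. by rewrite /transport_cost EFin_Rexpectation. Qed.

(** Both integrals are pulled back to [pi] along the projections, where the constraint is
    integrated. *)
Lemma weak_duality f pi : admissible_pairs c f -> couplings mu nu pi ->
  dual_gain mu nu f <= \int[pi]_z c z.
Proof.
move=> [/bounded_continuous_measurable b1 /bounded_continuous_measurable b2 fc].
move=> [pi1 pi2].
rewrite /dual_gain.
have mfst : measurable_fun [set: borel (X * Y)%type]
    (fst : borel (X * Y)%type -> borel X).
  by apply: continuous_borel_fun => z; exact: cvg_fst.
have msnd : measurable_fun [set: borel (X * Y)%type]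
    (snd : borel (X * Y)%type -> borel Y).
  by apply: continuous_borel_fun => z; exact: cvg_snd.
have [b1' e1] := Rexpectation_pushforward mfst b1 pi1.
have [b2' e2] := Rexpectation_pushforward msnd b2 pi2.
rewrite -e1 -e2 -RexpectationN// -RexpectationD//; last exact: bounded_measurableN.
apply: le_Rexpectation => //.
  exact: bounded_measurableD b1' (bounded_measurableN b2').
by case=> x y; exact: fc.
Qed.

End WeakDuality.

Theorem theorem8p1 (R : realType) (X Y : pmetricType R)
    (polishX : polish_space R X) (polishY : polish_space R Y)
    (lcX : locally_compact [set: X]) (lcY : locally_compact [set: Y])
    (c : X * Y -> R)
    (c_bounded : bounded_fun (c : X * Y -> R^o)) (c_lip : lipschitz_prod c)
    (mu : probability (borel X) R) (nu : probability (borel Y) R) :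
  [/\ ereal_sup (dual_value mu nu @` admissible_pairs c) =
        ereal_inf (transport_cost c @` couplings mu nu),
      exists2 f, admissible_pairs c f &
        dual_value mu nu f =
          ereal_sup (dual_value mu nu @` admissible_pairs c) &
      exists2 pi, couplings mu nu pi &
        transport_cost c pi =
          ereal_inf (transport_cost c @` couplings mu nu)].
Proof.
have [s ds] := separable_meets_balls polishX.1.
have [t dt] := separable_meets_balls polishY.1.
have [M cM] := bounded_fun_cst c_bounded.
have cc := lipschitz_prod_continuous c_lip.
have bc : bounded_measurable (c : borel (X * Y)%type -> R).
  by split; [exact: continuous_borel_measurable|exists M].
have improve := lipschitz_improvement c_lip cM mu nu.
have S0 : @dual_feasible R _ _ (borel X) (borel Y) c (2 * M) !=set0.
  have [//|//||g [_ Sg _]] := improve (cst (- M), cst 0); last by exists g.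
  - exact: bounded_measurable_cst.
  - exact: bounded_measurable_cst.
  - by move=> x y /=; rewrite subr0; have := cM (x, y); rewrite ler_norml => /andP[].
(* [f0] is optimal among measurable pairs bounded by [2 * M]; its improvement [f] is continuous and
   has at least the same gain. *)
have [f0 Sf0 f0max] := dual_maximizer mu nu S0.
have [bf01 bf02] := dual_feasible_bounded Sf0; have [_ _ _ f0c] := Sf0.
have [f [adm_f _ f0f]] := improve _ bf01 bf02 f0c.
(* Any bounded measurable pair improves to one bounded by [2 * M], so [f] is optimal whatever the
   bound of the competitor. *)
have fmax phi psi : bounded_measurable (phi : borel X -> R) ->
    bounded_measurable (psi : borel Y -> R) ->
    (forall x y, phi x - psi y <= c (x, y)) ->
    \int[mu]_x phi x - \int[nu]_y psi y <= dual_gain mu nu f.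
  move=> b1 b2 h; have [g [_ Sg gain_g]] := improve (phi, psi) b1 b2 h.
  exact: le_trans gain_g (le_trans (f0max _ Sg) f0f).
have [L [LD LZ L0 Lmarg Lc]] := marginal_functional mu nu (ex_intro _ M cM).
have [pi [cpi piP]] := coupling_of_functional ds lcX dt lcY LD L0 Lmarg.
(* The cost of [pi] is at most [L c], which is at most the dual optimum by [fmax]; weak duality
   gives the converse. *)
have pi_le : \int[pi]_z c z <= dual_gain mu nu f.
  apply: le_trans (Lc _ fmax).
  exact: (expectation_le_functional LZ Lmarg piP cc (ex_intro _ M cM)).
have pi_eq : \int[pi]_z c z = dual_gain mu nu f.
  by apply/le_anti; rewrite pi_le weak_duality.
have supE : ereal_sup (dual_value mu nu @` admissible_pairs c) =
    (dual_gain mu nu f)%:E.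
  apply/le_anti/andP; split.
    apply: ge_ereal_sup => _ [g adm_g <-].
    by rewrite (dual_valueE _ _ adm_g) lee_fin -pi_eq weak_duality.
  by rewrite -(dual_valueE _ _ adm_f); apply: ereal_sup_ubound; exists f.
have infE : ereal_inf (transport_cost c @` couplings mu nu) =
    (dual_gain mu nu f)%:E.
  apply/le_anti/andP; split.
    by rewrite -pi_eq -transport_costE//; apply: ereal_inf_lbound; exists pi.
  apply: le_ereal_inf_tmp => _ [rho crho <-].
  by rewrite transport_costE// lee_fin weak_duality.
split; first by rewrite supE infE.
- by exists f => //; rewrite supE (dual_valueE _ _ adm_f).
- by exists pi => //; rewrite infE transport_costE// pi_eq.
Qed.
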